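(* The divergence problem for polynomial probabilistic Petri nets with respect to an upward closed set is undecidable: there is no algorithm that, given a polynomial pPN $\mathcal N$ with initial marking $\mathbf m_0$ and an upward closed set $A\subseteq\mathbb{N}^P$ (given by its finitely many minimal elements), decides whether the Markov chain $\mathcal M_{\mathcal N}$ is divergent with respect to $\mathbf m_0$ and $A$.
   Context: A probabilistic Petri net (pPN) $\mathcal N=(P,T,\mathbf{Pre},\mathbf{Post},W,\mathbf m_0)$ has finite sets $P$ of places and $T$ of transitions, matrices $\mathbf{Pre},\mathbf{Post}\in\mathbb{N}^{P\times T}$, a computable weight function $W:T\times\mathbb{N}^P\to\mathbb{Q}_{>0}$ and an initial marking $\mathbf m_0\in\mathbb{N}^P$. A transition $t$ is enabled in marking $\mathbf m$ if $\mathbf m(p)\geq\mathbf{Pre}(p,t)$ for all $p$; firing it yields $\mathbf m'(p)=\mathbf m(p)+\mathbf{Post}(p,t)-\mathbf{Pre}(p,t)$. $\mathcal N$ is polynomial if for every $t$, $W(t,\cdot)$ is a positive polynomial (nonnegative coefficients, positive constant term) in the place markings. The Markov chain $\mathcal M_{\mathcal N}$ has as states the markings reachable from $\mathbf m_0$; in a marking $\mathbf m$ with no enabled transition, $\mathbf m$ loops with probability 1; otherwise, with $W(\mathbf m)=\sum_{t\text{ enabled}}W(t,\mathbf m)$, each enabled $t$ fires with probability $W(t,\mathbf m)/W(\mathbf m)$. For a Markov chain $\mathcal M=(S,p)$, $Post^*_{\mathcal M}(X)$ is the set of states reachable from $X$ and $\mathbf{Pr}_{\mathcal M,s}(\mathbf{F}X)$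 is the probability that the random path from $s$ ever (including time 0) is in $X$. $\mathcal M$ is divergent w.r.t. $s_0$ and $A$ if there exist computable $f_0,f_1:S\to\mathbb{R}_{\geq0}$ with: (a) for all $0<\theta<1$, $\mathbf{Pr}_{\mathcal M,s_0}(\mathbf{F}f_0^{-1}([0,\theta]))\leq\theta$; (b) for all $s$, $\mathbf{Pr}_{\mathcal M,s}(\mathbf{F}A)\leq f_1(s)$; (c) for all $0<\theta<1$, $\{s\mid f_0(s)\geq\theta\wedge f_1(s)\geq\theta\}\cap Post^*_{\mathcal M}(\{s_0\})$ is finite. A set $A\subseteq\mathbb{N}^P$ is upward closed if $\mathbf m\in A$ and $\mathbf m\leq\mathbf m'$ (componentwise) imply $\mathbf m'\in A$. *)

(* Defs.v *)
From Stdlib Require Import Reals List Arith ClassicalEpsilon.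
From Coquelicot Require Import Coquelicot.
Import ListNotations.
Open Scope R_scope.

(* A model of computation: counter (Minsky) machines.                   *)
(* Registers are indexed by nat; a program halts when its program       *)
(* counter leaves the program.                                          *)
Inductive instr : Type :=
| INC (r : nat)
| DEC (r j : nat).         (* if reg r = 0 then pc := j else (reg r -= 1; pc += 1) *)

Definition upd (regs : nat -> nat) (r v : nat) : nat -> nat :=
  fun x => if Nat.eqb x r then v else regs x.

Fixpoint exec (prog : list instr) (fuel pc : nat) (regs : nat -> nat)
  : option (nat -> nat) :=
  match nth_error prog pc with
  | None => Some regs
  | Some i =>
      match fuel with
      | O => None
      | S f =>
          match i with
          | INC r => exec prog f (S pc) (upd regs r (S (regs r)))
          | DEC r j =>
              match regs r with
              | O => exec prog f j regs
              | S v => exec prog f (S pc) (upd regs r v)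
              end
          end
      end
  end.

Definition init (l : list nat) : nat -> nat := fun x => nth x l 0%nat.

(* Cantor pairing and list encoding (Goedel numbering of inputs) *)
Definition cpair (a b : nat) : nat := (((a + b) * (a + b + 1)) / 2 + b)%nat.

Fixpoint enc_list {A : Type} (e : A -> nat) (l : list A) : nat :=
  match l with
  | [] => 0%nat
  | x :: t => S (cpair (e x) (enc_list e t))
  end.

Definition enc_nats (l : list nat) : nat := enc_list (fun x => x) l.

(* a monomial (num, den, exps) denotes (num/den) * prod_p m(p)^(exps p) *)
Definition monomial := (nat * nat * list nat)%type.
Definition poly := list monomial.
(* a transition: (Pre column, Post column, weight polynomial) *)
Definition transition := (list nat * list nat * poly)%type.

Record PPN := mkPPN {
  nplaces : nat;                  (* |P|, places are 0 .. nplaces-1 *)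
  ptrans  : list transition;
  pm0     : list nat;
  pAmin   : list (list nat)       (* minimal elements of the upward closed A *)
}.

Definition t_pre (t : transition) : list nat := fst (fst t).
Definition t_post (t : transition) : list nat := snd (fst t).
Definition t_poly (t : transition) : poly := snd t.

Definition enc_mono (mo : monomial) : nat :=
  let '(a, d, e) := mo in cpair a (cpair d (enc_nats e)).
Definition enc_trans (t : transition) : nat :=
  cpair (enc_nats (t_pre t)) (cpair (enc_nats (t_post t)) (enc_list enc_mono (t_poly t))).
Definition enc_ppn (N : PPN) : nat :=
  cpair (nplaces N) (cpair (enc_list enc_trans (ptrans N))
          (cpair (enc_nats (pm0 N)) (enc_list enc_nats (pAmin N)))).

Definition vle (n : nat) (a b : list nat) : Prop :=
  forall p, (p < n)%nat -> (nth p a 0%nat <= nth p b 0%nat)%nat.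

Definition valid_poly (n : nat) (q : poly) : Prop :=
  (forall a d e, In (a, d, e) q -> (0 < d)%nat /\ length e = n) /\
  (* positive constant term (coefficients are nonnegative by construction) *)
  (exists a d e, In (a, d, e) q /\ (0 < a)%nat /\ forall p, nth p e 0%nat = 0%nat).

Definition valid (N : PPN) : Prop :=
  let n := nplaces N in
  (forall t, In t (ptrans N) ->
      length (t_pre t) = n /\ length (t_post t) = n /\ valid_poly n (t_poly t)) /\
  length (pm0 N) = n /\
  (forall a, In a (pAmin N) -> length a = n) /\
  NoDup (pAmin N) /\
  (forall a b, In a (pAmin N) -> In b (pAmin N) -> vle n a b -> a = b).

Section Semantics.
Variable N : PPN.
Let n := nplaces N.

Definition enabledb (t : transition) (m : list nat) : bool :=
  forallb (fun p => Nat.leb (nth p (t_pre t) 0%nat) (nth p m 0%nat)) (seq 0%nat n).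

Definition fire (t : transition) (m : list nat) : list nat :=
  map (fun p => (nth p m 0 + nth p (t_post t) 0 - nth p (t_pre t) 0)%nat) (seq 0%nat n).

Definition eval_poly (q : poly) (m : list nat) : R :=
  fold_right Rplus 0
    (map (fun mo : monomial => let '(a, d, e) := mo in
            INR a / INR d *
            fold_right Rmult 1 (map (fun p => INR (nth p m 0%nat) ^ nth p e 0%nat) (seq 0%nat n)))
         q).

Definition weight (t : transition) (m : list nat) : R := eval_poly (t_poly t) m.

Definition enabled_list (m : list nat) : list transition :=
  filter (fun t => enabledb t m) (ptrans N).

Definition total_weight (m : list nat) : R :=
  fold_right Rplus 0 (map (fun t => weight t m) (enabled_list m)).

(* states of M_N: markings reachable from m0 *)
Inductive reachable : list nat -> Prop :=
| reach0 : reachable (pm0 N)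
| reachS : forall m t, reachable m -> In t (ptrans N) -> enabledb t m = true ->
             reachable (fire t m).

Definition decP (P : Prop) : bool :=
  if excluded_middle_informative P then true else false.

(* probability of visiting X within k steps (time 0 included) *)
Fixpoint within (X : list nat -> Prop) (k : nat) (m : list nat) : R :=
  if decP (X m) then 1 else
  match k with
  | O => 0
  | S k' =>
      match enabled_list m with
      | [] => within X k' m                    (* deadlock: self-loop w.p. 1 *)
      | en => fold_right Rplus 0
                (map (fun t => weight t m / total_weight m * within X k' (fire t m)) en)
      end
  end.

Definition PrF (X : list nat -> Prop) (m : list nat) : R :=
  real (Sup_seq (fun k => within X k m)).

Definition inA (m : list nat) : Prop :=
  exists a, In a (pAmin N) /\ vle n a m.

End Semantics.

Definition computable_real (f : list nat -> R) : Prop :=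
  exists prog : list instr, forall (m : list nat) (k : nat),
    exists fuel regs, exec prog fuel 0 (init [enc_nats m; k]) = Some regs /\
      Rabs (f m - INR (regs 0%nat) / INR (S (regs 1%nat))) <= / 2 ^ k.

Definition divergent (N : PPN) : Prop :=
  exists f0 f1 : list nat -> R,
    computable_real f0 /\ computable_real f1 /\
    (forall m, reachable N m -> 0 <= f0 m /\ 0 <= f1 m) /\
    (forall theta, 0 < theta < 1 ->
        PrF N (fun m => 0 <= f0 m <= theta) (pm0 N) <= theta) /\
    (forall m, reachable N m -> PrF N (inA N) m <= f1 m) /\
    (forall theta, 0 < theta < 1 ->
        exists L : list (list nat), forall m, reachable N m ->
          theta <= f0 m -> theta <= f1 m -> In m L).

Definition decides (prog : list instr) (P : PPN -> Prop) : Prop :=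
  forall N, valid N ->
    exists fuel regs, exec prog fuel 0 (init [enc_ppn N]) = Some regs /\
      (regs 0%nat = 1%nat <-> P N).

(* Main.v *)
(** Let [D] be a program that is supposed to decide divergence.  A counter machine computes the
    code of its own net (the data it needs are in the initial marking), runs [D] on it, and either
    halts, if [D] does not answer 1, or restarts.  A Petri net simulates the machine except that
    it may take the zero branch of a test on a positive counter; the weights give such a cheat
    probability O(1/K^2) at step K, and every restart visits the target set with probability 1/(K+2).

    If the machine restarts forever, then with probability at least 1/2 there is no cheat, and
    the restarts hit the target with probability bounded away from 0 (harmonic series) from every
    state of a faithful run: the net is not divergent.  If a faithful round halts, then after the
    next restart the target can only be hit again after a further cheat, so from step K on it is
    hit with probability O(1/K), and the net is divergent.  Either way the answer of [D] is wrong. *)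

From Stdlib Require Import Reals List Arith Lia Lra.
From Stdlib Require Import ClassicalEpsilon FunctionalExtensionality.
From Coquelicot Require Import Coquelicot.
Require Import Defs.
Import ListNotations.
Set Bullet Behavior "Strict Subproofs".
Open Scope R_scope.

(** * Reachability probabilities *)

(** A net cannot test for zero, and its weights see only the marking. Place 1 therefore counts the
    steps and lets polynomial weights make cheats ever rarer. The weights bound the cheat
    probability at step K by 1/(K+2) - 1/(K+3), so the bounds telescope: from step K on, all cheats
    along a faithful run cost at most 1/(K+2). The counter also bounds all other places, whence the
    finiteness in clause (c).

    Cheats reach many spurious markings, so a round must not depend on what they left behind. An
    input is read by moving it to a buffer and back, every instruction preserves the sum of input
    and buffer, and a round starts by erasing the work registers and emptying the buffers. Hence all
    faithful rounds have the same outcome.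

    The self-reference needs no fixed point. Places, transitions and target set do not depend on the
    initial marking, so their codes can be stored in it as plain numbers; the code of the marking is
    rebuilt from these numbers and the code of its tail. *)

Definition rsum (l : list R) : R := fold_right Rplus 0 l.

Lemma rsum_map_le {T} (g h : T -> R) (l : list T) :
  (forall x, In x l -> g x <= h x) -> rsum (map g l) <= rsum (map h l).
Proof.
  induction l as [|x l IH]; simpl; intros H; [lra|].
  pose proof (H x (or_introl eq_refl)).
  assert (rsum (map g l) <= rsum (map h l)) by (apply IH; auto). lra.
Qed.

Lemma rsum_map_scal {T} (c : R) (g : T -> R) (l : list T) :
  rsum (map (fun x => g x * c) l) = rsum (map g l) * c.
Proof. induction l as [|x l IH]; simpl; [ring|]. rewrite IH; ring. Qed.

Lemma rsum_map_pos {T} (g : T -> R) (l : list T) :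
  (forall x, In x l -> 0 < g x) -> l <> [] -> 0 < rsum (map g l).
Proof.
  destruct l as [|x l]; [easy|]; simpl; intros H _.
  assert (0 <= rsum (map g l)).
  { replace 0 with (rsum (map (fun _ : T => 0) l)).
    - apply rsum_map_le; intros; left; auto.
    - clear. induction l; simpl; lra. }
  pose proof (H x (or_introl eq_refl)). lra.
Qed.

Lemma eval_poly_pos N q m : valid_poly (nplaces N) q -> 0 < eval_poly N q m.
Proof.
  intros [Hd (a & d & e & Hin & Ha & He)].
  set (g := fun mo : monomial => let '(a, d, e) := mo in
            INR a / INR d *
            fold_right Rmult 1 (map (fun p => INR (nth p m 0%nat) ^ nth p e 0%nat)
                                    (seq 0%nat (nplaces N)))).
  change (0 < rsum (map g q)).
  assert (Hprod : forall (h : nat -> R) l, (forall p, 0 <= h p) ->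
            0 <= fold_right Rmult 1 (map h l)).
  { intros h l Hh; induction l; simpl; [lra|]. now apply Rmult_le_pos. }
  assert (H0 : forall mo, In mo q -> 0 <= g mo).
  { intros [[a' d'] e'] H; simpl. apply Rmult_le_pos.
    - apply Rdiv_le_0_compat; [apply pos_INR|]. apply lt_0_INR, (Hd _ _ _ H).
    - apply Hprod; intros; apply pow_le, pos_INR. }
  assert (H1 : 0 < g (a, d, e)).
  { simpl. replace (fold_right _ _ _) with 1.
    - rewrite Rmult_1_r. apply Rdiv_lt_0_compat; apply lt_0_INR; auto.
      apply (Hd _ _ _ Hin).
    - generalize (seq 0 (nplaces N)); intros l; induction l; simpl; [lra|].
      rewrite He, <- IHl; simpl; ring. }
  clear Hd He. induction q as [|mo q IH]; [easy|]; simpl.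
  assert (0 <= rsum (map g q)).
  { replace 0 with (rsum (map (fun _ : monomial => 0) q)).
    - apply rsum_map_le; intros; apply H0; now right.
    - clear. induction q; simpl; lra. }
  destruct Hin as [->|Hin]; [lra|].
  assert (0 < rsum (map g q)) by (apply IH; auto; intros; apply H0; now right).
  pose proof (H0 mo (or_introl eq_refl)). lra.
Qed.

Definition expect (N : PPN) (m : list nat) (g : list nat -> R) : R :=
  match enabled_list N m with
  | [] => g m
  | en => rsum (map (fun t => weight N t m / total_weight N m * g (fire N t m)) en)
  end.

Lemma within_0 N X m : within N X 0 m = if decP (X m) then 1 else 0.
Proof. reflexivity. Qed.

Lemma within_S N X k m :
  within N X (S k) m = if decP (X m) then 1 else expect N m (within N X k).
Proof. reflexivity. Qed.

Lemma decP_true (P : Prop) : P -> decP P = true.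
Proof. unfold decP; destruct excluded_middle_informative; easy. Qed.

Lemma decP_false (P : Prop) : ~ P -> decP P = false.
Proof. unfold decP; destruct excluded_middle_informative; easy. Qed.

Lemma decP_spec (P : Prop) : (P /\ decP P = true) \/ (~ P /\ decP P = false).
Proof. unfold decP; destruct excluded_middle_informative; auto. Qed.

Lemma within_in N X k m : X m -> within N X k m = 1.
Proof.
  intros H; destruct k; [rewrite within_0|rewrite within_S]; now rewrite decP_true.
Qed.

Section MarkovChain.
Variable N : PPN.
Hypothesis HN : valid N.

Lemma in_enabled_list t m :
  In t (enabled_list N m) -> In t (ptrans N) /\ enabledb N t m = true.
Proof. apply filter_In. Qed.

Lemma weight_pos t m : In t (ptrans N) -> 0 < weight N t m.
Proof. intros H. apply eval_poly_pos. destruct HN as [HT _]. apply HT, H. Qed.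

Lemma total_weight_pos m : enabled_list N m <> [] -> 0 < total_weight N m.
Proof.
  intros H. apply (rsum_map_pos (fun t => weight N t m)); auto.
  intros t Ht. apply weight_pos, (in_enabled_list _ _ Ht).
Qed.

Lemma expect_mono m (g h : list nat -> R) :
  reachable N m -> (forall m', reachable N m' -> g m' <= h m') ->
  expect N m g <= expect N m h.
Proof.
  intros Hm H. unfold expect. pose proof (in_enabled_list) as Hen.
  pose proof (total_weight_pos m) as Htot.
  destruct (enabled_list N m) as [|t0 l] eqn:E; [auto|].
  apply rsum_map_le. intros t Ht.
  destruct (Hen t m) as [Ht1 Ht2]; [now rewrite E|].
  apply Rmult_le_compat_l.
  - left. apply Rdiv_lt_0_compat; [now apply weight_pos|now apply Htot].
  - apply H. now constructor.
Qed.

Lemma expect_const m c : expect N m (fun _ => c) = c.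
Proof.
  unfold expect. pose proof (total_weight_pos m) as Htot.
  destruct (enabled_list N m) as [|t0 l] eqn:E; [auto|].
  rewrite rsum_map_scal. unfold Rdiv. rewrite rsum_map_scal.
  replace (rsum (map (fun t => weight N t m) (t0 :: l))) with (total_weight N m).
  - field. apply Rgt_not_eq, Htot. easy.
  - unfold total_weight. now rewrite E.
Qed.

(** Optional stopping at a finite horizon: replacing [within] by [V] one step at a time can only
    increase it. The upper bounds on hitting probabilities below all come from a choice of [V]. *)
Lemma within_le_supermartingale X V :
  (forall m, reachable N m -> 0 <= V m) ->
  (forall m, reachable N m -> X m -> 1 <= V m) ->
  (forall m, reachable N m -> ~ X m -> expect N m V <= V m) ->
  forall k m, reachable N m -> within N X k m <= V m.
Proof.
  intros H0 H1 HV. induction k as [|k IH]; intros m Hm.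
  - rewrite within_0. destruct (decP_spec (X m)) as [[HX ->]|[HX ->]]; auto.
  - rewrite within_S. destruct (decP_spec (X m)) as [[HX ->]|[HX ->]]; auto.
    eapply Rle_trans; [apply expect_mono; eauto|]. auto.
Qed.

Lemma within_le_1 X k m : reachable N m -> within N X k m <= 1.
Proof.
  intros Hm. apply (within_le_supermartingale X (fun _ => 1)); auto; try (intros; lra).
  intros. rewrite expect_const. lra.
Qed.

Lemma within_ge_0 X k m : reachable N m -> 0 <= within N X k m.
Proof.
  revert m; induction k as [|k IH]; intros m Hm.
  - rewrite within_0. destruct (decP _); lra.
  - rewrite within_S. destruct (decP _); [lra|].
    rewrite <- (expect_const m 0). now apply expect_mono.
Qed.

Lemma within_incr X k m : reachable N m -> within N X k m <= within N X (S k) m.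
Proof.
  revert m; induction k as [|k IH]; intros m Hm.
  - rewrite within_0. destruct (decP_spec (X m)) as [[HX ->]|[HX ->]].
    + rewrite within_in; [lra|auto].
    + now apply within_ge_0.
  - rewrite !(within_S _ _ _ m). destruct (decP _); [lra|].
    now apply expect_mono.
Qed.

Lemma within_mono_time X k l m :
  (k <= l)%nat -> reachable N m -> within N X k m <= within N X l m.
Proof.
  intros Hkl Hm; induction Hkl as [|l _ IH]; [lra|].
  eapply Rle_trans; [exact IH|now apply within_incr].
Qed.

Lemma PrF_le X m c :
  reachable N m -> (forall k, within N X k m <= c) -> PrF N X m <= c.
Proof.
  intros Hm H. unfold PrF.
  assert (Hs := Sup_seq_correct (fun k => Finite (within N X k m))).
  destruct (Sup_seq (fun k => Finite (within N X k m))) as [s| |]; simpl in *.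
  - apply Rnot_lt_le; intros Hlt.
    assert (He : 0 < s - c) by lra.
    destruct (Hs (mkposreal _ He)) as [_ [k Hk]]; simpl in Hk.
    specialize (H k); lra.
  (* [real] sends an infinite supremum to 0, and [c] is nonnegative because it bounds
     [within N X 0 m]. *)
  - eapply Rle_trans; [|apply (H 0%nat)]. now apply within_ge_0.
  - eapply Rle_trans; [|apply (H 0%nat)]. now apply within_ge_0.
Qed.

Lemma within_le_PrF X k m : reachable N m -> within N X k m <= PrF N X m.
Proof.
  intros Hm. unfold PrF.
  assert (Hs := Sup_seq_correct (fun k => Finite (within N X k m))).
  destruct (Sup_seq (fun k => Finite (within N X k m))) as [s| |]; simpl in *.
  - apply Rnot_lt_le; intros Hlt.
    assert (He : 0 < within N X k m - s) by lra.
    destruct (Hs (mkposreal _ He)) as [Hk _]; specialize (Hk k); simpl in Hk. lra.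
  - destruct (Hs 1) as [j Hj]. pose proof (within_le_1 X j m Hm). lra.
  - specialize (Hs 0 k). pose proof (within_ge_0 X k m Hm). lra.
Qed.

End MarkovChain.

(** * Counter machines and the nets that simulate them *)

(* [TEST r l j1 j0]: if register [r] is zero go to [j0], otherwise decrement it,
   increment the registers in [l] and go to [j1].  [FLAG] blocks the machine; the net
   restarts it from there. *)
Inductive ginstr : Type :=
| ADD (l : list nat) (j : nat)
| TEST (r : nat) (l : list nat) (j1 j0 : nat)
| FLAG.

Definition ind (p q : nat) : nat := if Nat.eqb p q then 1%nat else 0%nat.

Fixpoint cnt (p : nat) (l : list nat) : nat :=
  match l with [] => 0%nat | x :: l' => (ind p x + cnt p l')%nat end.

Definition addl (l : list nat) (v : nat -> nat) : nat -> nat := fun p => (v p + cnt p l)%nat.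

Definition cfg := (nat * (nat -> nat))%type.

Definition gstep (P : list ginstr) (c : cfg) : option cfg :=
  let '(i, v) := c in
  match nth_error P i with
  | Some (ADD l j) => Some (j, addl l v)
  | Some (TEST r l j1 j0) =>
      match v r with
      | O => Some (j0, v)
      | S k => Some (j1, addl l (upd v r k))
      end
  | _ => None
  end.

Fixpoint nsteps (P : list ginstr) (n : nat) (c : cfg) : option cfg :=
  match n with
  | O => Some c
  | S n' => match gstep P c with Some c' => nsteps P n' c' | None => None end
  end.

Lemma nsteps_add P n1 n2 c c1 :
  nsteps P n1 c = Some c1 -> nsteps P (n1 + n2) c = nsteps P n2 c1.
Proof.
  revert c; induction n1 as [|n1 IH]; simpl; intros c H.
  - now injection H as ->.
  - destruct (gstep P c); [auto|easy].
Qed.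

Lemma ind_refl p : ind p p = 1%nat.
Proof. unfold ind; now rewrite Nat.eqb_refl. Qed.

Lemma ind_neq p q : p <> q -> ind p q = 0%nat.
Proof. intros H; unfold ind. now apply Nat.eqb_neq in H; rewrite H. Qed.

Lemma cnt_le_length p l : (cnt p l <= length l)%nat.
Proof.
  induction l as [|x l IH]; simpl; [lia|].
  unfold ind; destruct (Nat.eqb p x); lia.
Qed.

Lemma cnt_notin p l : ~ In p l -> cnt p l = 0%nat.
Proof.
  induction l as [|x l IH]; simpl; intros H; [easy|].
  rewrite ind_neq, IH; firstorder.
Qed.

Lemma addl_nil v : addl [] v = v.
Proof. apply functional_extensionality; intros p; unfold addl; simpl; lia. Qed.

(** * The net of a machine program and its one-step behaviour *)

Section Net.
Variable P : list ginstr.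
Variable R0 : nat.
Variable v0 : nat -> nat.

Definition np : nat := (R0 + S (length P))%nat.

Definition vec (l : list nat) : list nat := map (fun p => cnt p l) (seq 0 np).

Definition exps (e : nat) : list nat :=
  map (fun p => if Nat.eqb p 1 then e else 0%nat) (seq 0 np).

Definition w_one : poly := [(1%nat, 1%nat, exps 0)].
Definition w_flag : poly := [(1%nat, 1%nat, exps 0); (1%nat, 1%nat, exps 1)].
(** 6 + 5K + K^2 = (K+2)(K+3). Against a cheat of weight 1 this gives the cheat probability
    1/((K+2)(K+3) + 1), just below 1/(K+2) - 1/(K+3). Likewise [w_flag], with value K+1 against
    weight 1, gives detection probability 1/(K+2). *)
Definition w_test : poly :=
  [(6%nat, 1%nat, exps 0); (5%nat, 1%nat, exps 1); (1%nat, 1%nat, exps 2)].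

Definition tr (d l : list nat) (w : poly) : transition := (vec d, vec l, w).

(* Place 1 counts the steps.  The zero branch of a [TEST] is always enabled: firing it on a
   positive register is a cheat, which has probability about 1/K^2 at step K. *)
Definition instr_trans (i : nat) (ins : ginstr) : list transition :=
  match ins with
  | ADD l j => [tr [R0 + i] (R0 + j :: 1 :: l) w_one]
  | TEST r l j1 j0 =>
      [tr [R0 + i; r] (R0 + j1 :: 1 :: l) w_test; tr [R0 + i] [R0 + j0; 1] w_one]
  | FLAG => [tr [R0 + i] [R0; 1] w_flag; tr [R0 + i] [0; 1] w_one]
  end%nat.

Fixpoint prog_trans (i : nat) (Q : list ginstr) : list transition :=
  match Q with
  | [] => []
  | ins :: Q' => instr_trans i ins ++ prog_trans (S i) Q'
  end.

Definition net_trans : list transition := prog_trans 0 P ++ [tr [0%nat] [R0; 1%nat] w_one].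

Definition mark (q : nat) (v : nat -> nat) (K : nat) : list nat :=
  map (fun p => (ind p q + ind p 1 * K + v p)%nat) (seq 0 np).

(** Place 0 is both the target place and a control location: the control token stays there for one
    step and then restarts the machine, so a visit to the target leaves the registers untouched. *)
Definition net : PPN := mkPPN np net_trans (mark R0 v0 0) [vec [0%nat]].

Definition wf_instr (ins : ginstr) : Prop :=
  match ins with
  | ADD l j => (forall r, In r l -> 2 <= r < R0) /\ j <= length P
  | TEST r l j1 j0 =>
      2 <= r < R0 /\ (forall r, In r l -> 2 <= r < R0) /\ j1 <= length P /\ j0 <= length P
  | FLAG => True
  end%nat.

Definition wf_regs (v : nat -> nat) : Prop := forall p, (p < 2 \/ R0 <= p)%nat -> v p = 0%nat.

Definition control (q : nat) : Prop := (q = 0 \/ R0 <= q)%nat /\ (q < np)%nat.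

Hypothesis HR : (2 <= R0)%nat.
Hypothesis HP : List.Forall wf_instr P.

Lemma nth_map_seq (f : nat -> nat) p : (p < np)%nat -> nth p (map f (seq 0 np)) 0%nat = f p.
Proof.
  intros H. rewrite nth_indep with (d' := f 0%nat) by now rewrite length_map, length_seq.
  rewrite map_nth, seq_nth; auto.
Qed.

Lemma nth_mark p q v K : (p < np)%nat -> nth p (mark q v K) 0%nat = (ind p q + ind p 1 * K + v p)%nat.
Proof. intros H; unfold mark; now rewrite nth_map_seq. Qed.

Lemma nth_vec p l : (p < np)%nat -> nth p (vec l) 0%nat = cnt p l.
Proof. intros H; unfold vec; now rewrite nth_map_seq. Qed.

Lemma valid_weights w : w = w_one \/ w = w_flag \/ w = w_test -> valid_poly np w.
Proof.
  assert (Hl : forall e, length (exps e) = np).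
  { intros; unfold exps; now rewrite length_map, length_seq. }
  assert (H0 : forall p, nth p (exps 0) 0%nat = 0%nat).
  { intros p. unfold exps. generalize (seq 0 np) as l. intros l; revert p.
    induction l as [|x l IH]; intros [|p]; simpl; auto. now destruct (Nat.eqb x 1). }
  intros [-> | [-> | ->]]; split;
    try (simpl; intros a d e H; repeat (destruct H as [[= <- <- <-]|H]; [auto|]); easy);
    simpl; do 3 eexists; (split; [left; reflexivity|]); split; auto; lia.
Qed.

Lemma in_prog_trans t s Q :
  In t (prog_trans s Q) <->
  exists i ins, nth_error Q i = Some ins /\ In t (instr_trans (s + i) ins).
Proof.
  revert s; induction Q as [|x Q IH]; intros s; simpl.
  - split; [easy|]. intros ([|i] & ins & H & _); easy.
  - rewrite in_app_iff, IH. split.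
    + intros [H | (i & ins & H1 & H2)].
      * exists 0%nat, x; rewrite Nat.add_0_r; auto.
      * exists (S i), ins; rewrite Nat.add_succ_r; auto.
    + intros ([|i] & ins & H1 & H2).
      * injection H1 as ->. rewrite Nat.add_0_r in H2; auto.
      * right; exists i, ins; rewrite Nat.add_succ_r in H2; auto.
Qed.

Lemma net_trans_shape t :
  In t net_trans -> exists d l w, t = tr d l w /\ (w = w_one \/ w = w_flag \/ w = w_test).
Proof.
  unfold net_trans. rewrite in_app_iff, in_prog_trans.
  intros [(i & ins & _ & H) | [<-|[]]].
  - destruct ins; simpl in H; repeat (destruct H as [<-|H]; [do 3 eexists; eauto|]); easy.
  - do 3 eexists; eauto.
Qed.

Lemma net_valid : valid net.
Proof.
  unfold valid; cbn [nplaces ptrans pm0 pAmin net].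
  assert (Hl : forall l, length (vec l) = np).
  { intros; unfold vec; now rewrite length_map, length_seq. }
  split; [|split; [|split; [|split]]].
  - intros t Ht. destruct (net_trans_shape t Ht) as (d & l & w & -> & Hw); simpl.
    unfold tr, t_pre, t_post; simpl. auto using valid_weights.
  - unfold mark; now rewrite length_map, length_seq.
  - intros a [<-|[]]; auto.
  - repeat constructor; easy.
  - intros a b [<-|[]] [<-|[]]; auto.
Qed.

Lemma weight_eval (q : nat) v K e : (q <> 1)%nat -> wf_regs v ->
  fold_right Rmult 1
    (map (fun p => INR (nth p (mark q v K) 0%nat) ^ nth p (exps e) 0%nat) (seq 0%nat np))
  = INR K ^ e.
Proof.
  intros Hq Hv.
  assert (H1 : nth 1 (mark q v K) 0%nat = K).
  { rewrite nth_mark by (unfold np; lia). rewrite ind_neq, ind_refl, Hv; lia. }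
  rewrite map_ext_in with (g := fun p => INR (nth p (mark q v K) 0%nat) ^ (if Nat.eqb p 1 then e else 0%nat)).
  2: { intros p Hp. apply in_seq in Hp. unfold exps. rewrite nth_map_seq by lia. reflexivity. }
  assert (Hnp : (2 <= np)%nat) by (unfold np; lia).
  destruct np as [|[|n]]; try lia. simpl. rewrite H1.
  replace (fold_right _ _ _) with 1; [ring|].
  assert (H : forall n s, (2 <= s)%nat -> 1 = fold_right Rmult 1
    (map (fun p => INR (nth p (mark q v K) 0%nat) ^ (if Nat.eqb p 1 then e else 0%nat)) (seq s n))).
  { clear. induction n as [|n IH]; intros s Hs; simpl; [easy|].
    rewrite <- IH by lia. destruct (Nat.eqb_spec s 1); [lia|]. simpl; ring. }
  now apply H.
Qed.

Lemma control_neq1 q : control q -> (q <> 1)%nat.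
Proof. unfold control; lia. Qed.

Lemma weight_one d l q v K : control q -> wf_regs v -> weight net (tr d l w_one) (mark q v K) = 1.
Proof.
  intros Hq Hv. unfold weight, eval_poly; cbn [t_poly tr snd w_one map fold_right nplaces net].
  rewrite !weight_eval by (auto using control_neq1). simpl; lra.
Qed.

Lemma weight_flag d l q v K : control q -> wf_regs v ->
  weight net (tr d l w_flag) (mark q v K) = INR K + 1.
Proof.
  intros Hq Hv. unfold weight, eval_poly; cbn [t_poly tr snd w_flag map fold_right nplaces net].
  rewrite !weight_eval by (auto using control_neq1). simpl; field.
Qed.

Lemma weight_test d l q v K : control q -> wf_regs v ->
  weight net (tr d l w_test) (mark q v K) = INR K ^ 2 + 5 * INR K + 6.
Proof.
  intros Hq Hv. unfold weight, eval_poly; cbn [t_poly tr snd w_test map fold_right nplaces net].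
  rewrite !weight_eval by (auto using control_neq1). simpl; field.
Qed.

Lemma enabledb_iff d l w q v K :
  enabledb net (tr d l w) (mark q v K) = true <->
  forall p, (p < np)%nat -> (cnt p d <= ind p q + ind p 1 * K + v p)%nat.
Proof.
  unfold enabledb. rewrite forallb_forall. cbn [nplaces net].
  split; intros H p Hp.
  - specialize (H p). rewrite in_seq in H. apply Nat.leb_le in H; [|lia].
    rewrite nth_mark in H by auto. unfold tr, t_pre in H; simpl in H.
    rewrite nth_vec in H by auto. exact H.
  - apply in_seq in Hp. apply Nat.leb_le. rewrite nth_mark by lia.
    unfold tr, t_pre; simpl. rewrite nth_vec by lia. apply H; lia.
Qed.

Lemma enabledb_control c l w q v K : control c -> control q -> wf_regs v ->
  enabledb net (tr [c] l w) (mark q v K) = Nat.eqb c q.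
Proof.
  intros Hc Hq Hv. destruct (Nat.eqb_spec c q) as [->|Hne].
  - apply enabledb_iff. intros p Hp; simpl; lia.
  - apply Bool.not_true_is_false. rewrite enabledb_iff. intros H.
    destruct Hc as [Hc1 Hc2]. specialize (H c Hc2). simpl in H.
    rewrite ind_refl, (ind_neq c q), (ind_neq c 1), Hv in H; lia.
Qed.

Lemma enabledb_control_reg c r l w q v K :
  control c -> control q -> wf_regs v -> (2 <= r < R0)%nat ->
  enabledb net (tr [c; r] l w) (mark q v K) = (Nat.eqb c q && Nat.leb 1 (v r))%bool.
Proof.
  intros Hc Hq Hv Hr.
  assert (Hcr : c <> r) by (destruct Hc; lia).
  assert (Hqr : q <> r) by (destruct Hq; lia).
  assert (Hrn : (r < np)%nat) by (unfold np; lia).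
  destruct (Nat.eqb_spec c q) as [->|Hne]; simpl.
  - destruct (v r) as [|k] eqn:E.
    + apply Bool.not_true_is_false. rewrite enabledb_iff. intros H.
      specialize (H r Hrn). simpl in H.
      rewrite ind_refl, (ind_neq r q), (ind_neq r 1), E in H; lia.
    + apply enabledb_iff. intros p Hp; simpl.
      destruct (Nat.eq_dec p r) as [->|Hpr]; [rewrite ind_refl, E; lia|].
      rewrite (ind_neq p r); lia.
  - apply Bool.not_true_is_false. rewrite enabledb_iff. intros H.
    destruct Hc as [Hc1 Hc2]. specialize (H c Hc2). simpl in H.
    rewrite ind_refl, (ind_neq c q), (ind_neq c 1), Hv in H; lia.
Qed.

Lemma fire_control q q' l w v K : 
  fire net (tr [q] (q' :: 1%nat :: l) w) (mark q v K) = mark q' (addl l v) (S K).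
Proof.
  unfold fire, mark at 2; cbn [nplaces net]. apply map_ext_in; intros p Hp.
  apply in_seq in Hp. rewrite nth_mark by lia. unfold tr, t_post, t_pre; cbn [fst snd].
  rewrite !nth_vec by lia. simpl. unfold addl. lia.
Qed.

Lemma fire_control_reg q r q' l w v K k :
  v r = S k ->
  fire net (tr [q; r] (q' :: 1%nat :: l) w) (mark q v K) = mark q' (addl l (upd v r k)) (S K).
Proof.
  intros Hr. unfold fire, mark at 2; cbn [nplaces net]. apply map_ext_in; intros p Hp.
  apply in_seq in Hp. rewrite nth_mark by lia. unfold tr, t_post, t_pre; cbn [fst snd].
  rewrite !nth_vec by lia. simpl. unfold addl.
  assert (upd v r k p + ind p r = v p)%nat; [|lia].
  unfold upd, ind. destruct (Nat.eqb_spec p r) as [->|]; lia.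
Qed.

Lemma control_pc i : (i <= length P)%nat -> control (R0 + i).
Proof. unfold control, np; lia. Qed.

Lemma control_start : control R0.
Proof. unfold control, np; lia. Qed.

Lemma control_0 : control 0.
Proof. unfold control, np; lia. Qed.

Lemma wf_nth i ins : nth_error P i = Some ins -> wf_instr ins /\ (i < length P)%nat.
Proof.
  intros H. split.
  - rewrite Forall_forall in HP. apply HP. eapply nth_error_In; eauto.
  - apply nth_error_Some. congruence.
Qed.

(** Every transition of instruction [i] takes a token from place [R0 + i], and [q] is the only
    marked control place. *)
Lemma instr_trans_disabled i ins t q v K :
  (i <= length P)%nat -> wf_instr ins -> control q -> wf_regs v -> q <> (R0 + i)%nat ->
  In t (instr_trans i ins) -> enabledb net t (mark q v K) = false.
Proof.
  intros Hi Hw Hq Hv Hne Hin. pose proof (control_pc i Hi).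
  destruct ins; simpl in Hin, Hw; repeat (destruct Hin as [<-|Hin]); try easy;
    rewrite ?enabledb_control, ?enabledb_control_reg by tauto;
    (destruct (Nat.eqb_spec (R0 + i) q); [lia|reflexivity]).
Qed.

Lemma filter_prog_trans_none f s Q :
  (forall i ins t, nth_error Q i = Some ins -> In t (instr_trans (s + i) ins) -> f t = false) ->
  filter f (prog_trans s Q) = [].
Proof.
  revert s; induction Q as [|x Q IH]; intros s H; simpl; [easy|].
  rewrite filter_app, IH, app_nil_r.
  - rewrite <- (Nat.add_0_r s) at 1. assert (H' := fun t => H 0%nat x t eq_refl).
    revert H'. generalize (instr_trans (s + 0) x). intros l Hl.
    induction l as [|t l IHl]; simpl; [easy|]. rewrite (Hl t) by now left.
    apply IHl. intros; apply Hl; now right.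
  - intros i ins t Hi Ht. apply (H (S i) ins); auto. now rewrite Nat.add_succ_r.
Qed.

Lemma filter_prog_trans f s Q i ins :
  nth_error Q i = Some ins ->
  (forall i' ins' t, i' <> i -> nth_error Q i' = Some ins' ->
     In t (instr_trans (s + i') ins') -> f t = false) ->
  filter f (prog_trans s Q) = filter f (instr_trans (s + i) ins).
Proof.
  revert s i; induction Q as [|x Q IH]; intros s [|i] Hi H; try easy; simpl; rewrite filter_app.
  - injection Hi as ->. rewrite filter_prog_trans_none, app_nil_r, Nat.add_0_r; [easy|].
    intros i' ins' t Hi' Ht. apply (H (S i') ins'); auto. now rewrite Nat.add_succ_r.
  - rewrite (IH (S s) i) by (auto; intros i' ins' t Hne Hi' Ht;
      apply (H (S i') ins'); auto; now rewrite Nat.add_succ_r).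
    rewrite Nat.add_succ_r. replace (filter f (instr_trans s x)) with (@nil transition); [easy|].
    symmetry. assert (H' := fun t => H 0%nat x t ltac:(easy) eq_refl).
    rewrite Nat.add_0_r in H'. revert H'. generalize (instr_trans s x). intros l Hl.
    induction l as [|t l IHl]; simpl; [easy|]. rewrite (Hl t) by now left.
    apply IHl. intros; apply Hl; now right.
Qed.

Lemma enabled_list_pc i ins v K :
  nth_error P i = Some ins -> wf_regs v ->
  enabled_list net (mark (R0 + i) v K) =
  filter (fun t => enabledb net t (mark (R0 + i) v K)) (instr_trans i ins).
Proof.
  intros Hi Hv. destruct (wf_nth i ins Hi) as [_ Hlt].
  assert (Hc : control (R0 + i)) by (apply control_pc; lia).
  unfold enabled_list; cbn [ptrans net]. unfold net_trans. rewrite filter_app.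
  rewrite (filter_prog_trans _ 0 P i ins) by
    (auto; intros i' ins' t Hne Hi' Ht; destruct (wf_nth i' ins' Hi');
     apply (instr_trans_disabled i' ins'); auto; lia).
  simpl. rewrite enabledb_control by (auto using control_0).
  destruct (Nat.eqb_spec 0 (R0 + i)); [lia|]. apply app_nil_r.
Qed.

Lemma enabled_list_other q v K :
  control q -> wf_regs v -> (q = 0 \/ q = R0 + length P)%nat ->
  enabled_list net (mark q v K) = if Nat.eqb q 0 then [tr [0%nat] [R0; 1%nat] w_one] else [].
Proof.
  intros Hc Hv Hq. unfold enabled_list; cbn [ptrans net]. unfold net_trans. rewrite filter_app.
  rewrite filter_prog_trans_none by
    (auto; intros i' ins' t Hi' Ht; destruct (wf_nth i' ins' Hi');
     apply (instr_trans_disabled i' ins'); auto; lia).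
  simpl. rewrite enabledb_control by (auto using control_0). now destruct q.
Qed.

Lemma reachable_enabled_list m t :
  reachable net m -> In t (enabled_list net m) -> reachable net (fire net t m).
Proof. intros Hm Ht. apply in_enabled_list in Ht. now constructor. Qed.

Lemma expect_halt v K g : wf_regs v ->
  expect net (mark (R0 + length P) v K) g = g (mark (R0 + length P) v K).
Proof.
  intros Hv. unfold expect. rewrite enabled_list_other; auto using control_pc.
  destruct (Nat.eqb_spec (R0 + length P) 0); [lia|easy].
Qed.

Lemma step_detected v K g : wf_regs v ->
  expect net (mark 0 v K) g = g (mark R0 v (S K)) /\
  (reachable net (mark 0 v K) -> reachable net (mark R0 v (S K))).
Proof.
  intros Hv. pose proof (reachable_enabled_list (mark 0 v K)) as Hr.
  unfold expect, total_weight. rewrite enabled_list_other in Hr |- * by auto using control_0.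
  simpl in *. rewrite fire_control, addl_nil. rewrite weight_one by auto using control_0.
  split; [field|]. intros H. specialize (Hr _ H (or_introl eq_refl)).
  now rewrite fire_control, addl_nil in Hr.
Qed.

Lemma step_flag i v K g : nth_error P i = Some FLAG -> wf_regs v ->
  expect net (mark (R0 + i) v K) g =
    (1 - / (INR K + 2)) * g (mark R0 v (S K)) + / (INR K + 2) * g (mark 0 v (S K)) /\
  (reachable net (mark (R0 + i) v K) ->
   reachable net (mark R0 v (S K)) /\ reachable net (mark 0 v (S K))).
Proof.
  intros Hi Hv. destruct (wf_nth i _ Hi) as [_ Hlt].
  assert (Hc : control (R0 + i)) by (apply control_pc; lia).
  assert (He : enabled_list net (mark (R0 + i) v K) = instr_trans i FLAG).
  { rewrite (enabled_list_pc i FLAG) by auto. simpl.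
    now rewrite !enabledb_control, Nat.eqb_refl. }
  split.
  - unfold expect, total_weight. rewrite He. simpl.
    rewrite !fire_control, !addl_nil, weight_flag, weight_one by auto.
    pose proof (pos_INR K). field. lra.
  - intros H. pose proof (fun t => reachable_enabled_list _ t H) as Hr. rewrite He in Hr.
    simpl in Hr. split.
    + rewrite <- (addl_nil v) at 1.
      erewrite <- (fire_control (R0 + i)). apply Hr. left; reflexivity.
    + rewrite <- (addl_nil v) at 1.
      erewrite <- (fire_control (R0 + i)). apply Hr. right; left; reflexivity.
Qed.

(* [eps] is the probability of a cheat; when none is possible, [eps = 0] and the target [jb]
   is irrelevant. *)
Lemma step_machine i v K i' v' :
  gstep P (i, v) = Some (i', v') -> wf_regs v ->
  exists eps jb, 0 <= eps <= / ((INR K + 2) * (INR K + 3)) /\ (jb <= length P)%nat /\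
    (forall g, expect net (mark (R0 + i) v K) g =
       (1 - eps) * g (mark (R0 + i') v' (S K)) + eps * g (mark (R0 + jb) v (S K))) /\
    (reachable net (mark (R0 + i) v K) ->
     reachable net (mark (R0 + i') v' (S K)) /\
     (eps = 0 \/ reachable net (mark (R0 + jb) v (S K)))).
Proof.
  intros Hs Hv. unfold gstep in Hs.
  destruct (nth_error P i) as [ins|] eqn:Hi; [|easy].
  destruct (wf_nth i _ Hi) as [Hw Hlt].
  assert (Hc : control (R0 + i)) by (apply control_pc; lia).
  pose proof (pos_INR K) as HK.
  assert (HB : 0 < / ((INR K + 2) * (INR K + 3))).
  { apply Rinv_0_lt_compat. apply Rmult_lt_0_compat; lra. }
  pose proof (enabled_list_pc i ins v K Hi Hv) as He.
  pose proof (fun t H => reachable_enabled_list (mark (R0 + i) v K) t H) as Hr.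
  destruct ins as [l j|r l j1 j0|]; [| |easy].
  - injection Hs as <- <-. simpl in He. rewrite enabledb_control, Nat.eqb_refl in He by auto.
    exists 0, 0%nat. split; [lra|]. split; [lia|]. split.
    + intros g. unfold expect, total_weight. rewrite He. simpl.
      rewrite fire_control, weight_one by auto. field.
    + intros H. split; [|now left]. rewrite He in Hr.
      erewrite <- (fire_control (R0 + i)). apply Hr; auto. left; reflexivity.
  - simpl in He, Hw. rewrite enabledb_control, enabledb_control_reg, Nat.eqb_refl in He by tauto.
    destruct (v r) as [|k] eqn:Er; injection Hs as <- <-; simpl in He.
    + exists 0, 0%nat. split; [lra|]. split; [lia|]. split.
      * intros g. unfold expect, total_weight. rewrite He. simpl.
        rewrite fire_control, addl_nil, weight_one by auto. field.
      * intros H. split; [|now left]. rewrite He in Hr. rewrite <- (addl_nil v) at 1.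
        erewrite <- (fire_control (R0 + i)). apply Hr; auto. left; reflexivity.
    (* Weight 1 of the dishonest zero branch over the total weight (K+2)(K+3) + 1. *)
    + exists (/ (INR K ^ 2 + 5 * INR K + 7)), j0. split.
      { split.
        - left. apply Rinv_0_lt_compat. nra.
        - apply Rinv_le_contravar; nra. }
      split; [tauto|]. split.
      * intros g. unfold expect, total_weight. rewrite He. cbn [map fold_right rsum].
        rewrite (fire_control_reg _ _ _ _ _ _ _ k Er), fire_control, addl_nil.
        rewrite weight_test, weight_one by auto. field. nra.
      * intros H. rewrite He in Hr. split; [|right].
        -- erewrite <- (fire_control_reg (R0 + i) r) by eauto. apply Hr; auto. left; reflexivity.
        -- rewrite <- (addl_nil v) at 1.
           erewrite <- (fire_control (R0 + i)). apply Hr; auto. right; left; reflexivity.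
Qed.

Lemma inA_mark q v K : control q -> wf_regs v -> inA net (mark q v K) <-> q = 0%nat.
Proof.
  intros Hq Hv. unfold inA, vle; simpl. split.
  - intros (a & [<-|[]] & H). assert (H0 : (0 < np)%nat) by (unfold np; lia).
    specialize (H 0%nat H0). rewrite nth_vec, nth_mark in H by auto. simpl in H.
    rewrite Hv in H by lia. destruct q; [easy|]. cbn in H. lia.
  - intros ->. exists (vec [0%nat]). split; [now left|]. intros p Hp.
    rewrite nth_vec, nth_mark by auto. simpl. lia.
Qed.

Lemma nth_mark_0 q v K : wf_regs v -> nth 0 (mark q v K) 0%nat = ind 0 q.
Proof. intros Hv. rewrite nth_mark by (unfold np; lia). rewrite Hv by lia. simpl. lia. Qed.

Lemma nth_mark_1 q v K : control q -> wf_regs v -> nth 1 (mark q v K) 0%nat = K.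
Proof.
  intros Hq Hv. apply control_neq1 in Hq. rewrite nth_mark by (unfold np; lia).
  rewrite ind_neq, Hv by lia. simpl. lia.
Qed.

Section Invariant.
Variable J : nat -> (nat -> nat) -> Prop.
Hypothesis J_wf : forall K v, J K v -> wf_regs v.
Hypothesis J_init : J 0 v0.
Hypothesis J_skip : forall K v, J K v -> J (S K) v.
Hypothesis J_step : forall K v i i' v', J K v -> gstep P (i, v) = Some (i', v') -> J (S K) v'.

(** A cheat moves the control token but changes no register, so [J_skip] covers cheats as well as
    detections and restarts. [J] may mention the counter because the bound on the register contents
    grows with it. *)
Lemma reachable_mark m :
  reachable net m -> exists q v K, m = mark q v K /\ control q /\ J K v.
Proof.
  induction 1 as [|m t Hm (q & v & K & -> & Hq & HJ) Ht Hen].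
  - exists R0, v0, 0%nat. auto using control_start.
  - pose proof (J_wf _ _ HJ) as Hv.
    simpl in Ht. unfold net_trans in Ht. rewrite in_app_iff, in_prog_trans in Ht.
    destruct Ht as [(i & ins & Hi & Ht) | [<-|[]]].
    + simpl in Ht. destruct (wf_nth i ins Hi) as [Hw Hlt].
      assert (q = R0 + i)%nat as ->.
      { destruct (Nat.eq_dec q (R0 + i)) as [|Hne]; [auto|].
        rewrite (instr_trans_disabled i ins) in Hen; auto; [easy|lia]. }
      specialize (J_step K v i). simpl in J_step. rewrite Hi in J_step.
      destruct ins as [l j|r l j1 j0|]; simpl in Ht, Hw.
      * destruct Ht as [<-|[]]. rewrite fire_control. do 3 eexists; split; [reflexivity|].
        split; [apply control_pc; tauto|]. eapply J_step; eauto.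
      * destruct Ht as [<-|[<-|[]]].
        -- rewrite enabledb_control_reg, Nat.eqb_refl in Hen by tauto.
           destruct (v r) as [|k] eqn:E; [easy|].
           rewrite (fire_control_reg _ _ _ _ _ _ _ k E). do 3 eexists; split; [reflexivity|].
           split; [apply control_pc; tauto|]. eapply J_step; eauto.
        -- rewrite fire_control, addl_nil. do 3 eexists; split; [reflexivity|].
           split; [apply control_pc; tauto|]. auto.
      * destruct Ht as [<-|[<-|[]]]; rewrite fire_control, addl_nil;
          do 3 eexists; (split; [reflexivity|]); auto using control_start, control_0.
    + rewrite enabledb_control in Hen by auto using control_0.
      apply Nat.eqb_eq in Hen. subst q. rewrite fire_control, addl_nil.
      do 3 eexists; split; [reflexivity|]. auto using control_start.
Qed.

End Invariant.
End Net.

(** * Divergence of a net whose machine halts after every restart *)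

(** [FLAG] blocks [gstep], so a halting run meets no flag: from a good configuration place 0 can be
    reached only after a cheat. *)
Definition good (P : list ginstr) (c : cfg) : Prop :=
  exists n c', nsteps P n c = Some c' /\ nth_error P (fst c') = None.

Lemma good_step P c c' : gstep P c = Some c' -> good P c -> good P c'.
Proof.
  intros Hs ([|n] & c'' & Hn & Hh).
  - injection Hn as <-. destruct c as [i v]. simpl in Hs, Hh. now rewrite Hh in Hs.
  - simpl in Hn. rewrite Hs in Hn. now exists n, c''.
Qed.

Lemma flag_not_good P i v : nth_error P i = Some FLAG -> ~ good P (i, v).
Proof.
  intros Hi ([|n] & c' & Hn & Hh).
  - injection Hn as <-. simpl in Hh. congruence.
  - simpl in Hn. now rewrite Hi in Hn.
Qed.

(* The two certificates of divergence: [f0] is [marking_val true], [f1] is [marking_val false]. *)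
Definition marking_val (b : bool) (m : list nat) : R :=
  if Bool.eqb (Nat.eqb (nth 0 m 0%nat) 0) b then 1 else 2 / INR (S (nth 1 m 0%nat)).

Fixpoint bounded_lists (n b : nat) : list (list nat) :=
  match n with
  | O => [[]]
  | S n' => flat_map (fun x => map (cons x) (bounded_lists n' b)) (seq 0 (S b))
  end.

Lemma in_bounded_lists n b l :
  length l = n -> (forall x, In x l -> (x <= b)%nat) -> In l (bounded_lists n b).
Proof.
  revert l; induction n as [|n IH]; intros [|x l] Hl Hb; try easy.
  - now left.
  - cbn [bounded_lists]. apply in_flat_map. exists x. split.
    + apply in_seq. specialize (Hb x (or_introl eq_refl)). lia.
    + apply in_map, IH; [now injection Hl|]. intros; apply Hb; now right.
Qed.

Section NetBehaviour.
Variable P : list ginstr.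
Variable R0 : nat.
Variable v0 : nat -> nat.
Hypothesis HR : (2 <= R0)%nat.
Hypothesis HP : List.Forall (wf_instr P R0) P.
Variable I : (nat -> nat) -> Prop.
Hypothesis I_wf : forall v, I v -> wf_regs R0 v.
Hypothesis I_init : I v0.
Hypothesis I_step : forall v i i' v', I v -> gstep P (i, v) = Some (i', v') -> I v'.

Notation N := (net P R0 v0).
Notation mk := (mark P R0).

Lemma reachable_invariant m :
  reachable N m -> exists q v K, m = mk q v K /\ control P R0 q /\ I v.
Proof.
  apply (reachable_mark P R0 v0 HR HP (fun _ v => I v)); eauto.
Qed.

(** A step adds at most [c] tokens to a register, and place 1 tells how many steps were made. In the
    witness, 1 accounts for the control token and K for place 1 itself. *)
Lemma reachable_bounded :
  exists B : nat -> nat, forall m p, reachable N m -> (nth p m 0 <= B (nth 1 m 0))%nat.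
Proof.
  set (c := list_max (map (fun ins =>
              match ins with ADD l _ => length l | TEST _ l _ _ => length l | FLAG => 0%nat end) P)).
  set (b := list_max (map v0 (seq 0 R0))).
  exists (fun K => 1 + K + (b + c * K))%nat. intros m p Hm.
  destruct (reachable_mark P R0 v0 HR HP
              (fun K v => I v /\ forall p, v p <= b + c * K)%nat) with (m := m)
    as (q & v & K & -> & Hq & HI & Hb); auto.
  - firstorder.
  - split; [auto|]. intros p'. destruct (Nat.lt_ge_cases p' R0) as [Hp|Hp].
    + assert (Hall := proj1 (list_max_le (map v0 (seq 0 R0)) b) (Nat.le_refl _)).
      rewrite Forall_forall in Hall. specialize (Hall (v0 p')). fold b. rewrite Nat.mul_0_r, Nat.add_0_r.
      apply Hall, in_map, in_seq. lia.
    + rewrite (I_wf _ I_init); lia.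
  - intros K v [HI Hb]. split; [auto|]. intros p'. specialize (Hb p'). lia.
  - intros K v i i' v' [HI Hb] Hs. split; [eauto|]. intros p'. specialize (Hb p').
    simpl in Hs. destruct (nth_error P i) as [ins|] eqn:Hi; [|easy].
    assert (Hc := proj1 (list_max_le _ c) (Nat.le_refl _)).
    rewrite Forall_forall in Hc. apply nth_error_In in Hi.
    specialize (Hc _ (in_map _ _ _ Hi)). simpl in Hc.
    destruct ins as [l j|r l j1 j0|]; [| |easy].
    + injection Hs as <- <-. unfold addl. pose proof (cnt_le_length p' l). lia.
    + destruct (v r) as [|k] eqn:E; injection Hs as <- <-; [lia|].
      unfold addl, upd. pose proof (cnt_le_length p' l).
      destruct (Nat.eqb_spec p' r) as [->|]; lia.
  - rewrite nth_mark_1 by auto.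
    destruct (Nat.lt_ge_cases p (np P R0)) as [Hp|Hp].
    + rewrite nth_mark by auto. specialize (Hb p). unfold ind.
      destruct (Nat.eqb p q), (Nat.eqb p 1); lia.
    + rewrite nth_overflow; [lia|]. unfold mark. now rewrite length_map, length_seq.
Qed.

Lemma control_cases q : control P R0 q ->
  q = 0%nat \/ exists i, q = (R0 + i)%nat /\ (i <= length P)%nat.
Proof.
  unfold control, np. intros [[->|H1] H2]; [now left|right].
  exists (q - R0)%nat. lia.
Qed.

Lemma pc_cases i v : (i <= length P)%nat ->
  i = length P \/ nth_error P i = Some FLAG \/ exists c', gstep P (i, v) = Some c'.
Proof.
  intros Hi. simpl. destruct (nth_error P i) as [[l j|r l j1 j0|]|] eqn:E; auto.
  - right; right; eauto.
  - right; right. destruct (v r); eauto.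
  - left. apply nth_error_None in E. lia.
Qed.

Definition good_marking (m : list nat) : Prop :=
  exists i v K, m = mk (R0 + i) v K /\ I v /\ (i <= length P)%nat /\ good P (i, v).

(* Supermartingale for reaching place 0 at a step K with 2/(K+1) <= th.  From a good
   configuration a cheat must happen first, hence the factor 2 between both cases. *)
Definition pot (th : R) (m : list nat) : R :=
  let K := INR (nth 1 m 0%nat) in
  if Rle_dec (2 / (K + 1)) th then
    if Nat.eqb (nth 0 m 0%nat) 0 then
      if decP (good_marking m) then 1 / (K + 2) else 2 / (K + 2)
    else 1
  else th.

Lemma frac_decr c x y : 0 <= c -> 0 < x -> x <= y -> c / y <= c / x.
Proof.
  intros Hc Hx Hxy. unfold Rdiv. apply Rmult_le_compat_l; [auto|].
  now apply Rinv_le_contravar.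
Qed.

Lemma frac_pos c x : 0 < c -> 0 < x -> 0 < c / x.
Proof. apply Rdiv_lt_0_compat. Qed.

Lemma pot_pc th i v K : (i <= length P)%nat -> I v ->
  pot th (mk (R0 + i) v K) <= if Rle_dec (2 / (INR K + 1)) th then 2 / (INR K + 2) else th.
Proof.
  intros Hi Hv. unfold pot. rewrite nth_mark_1, nth_mark_0 by (auto using control_pc).
  rewrite ind_neq by lia. simpl. destruct Rle_dec; [|lra].
  pose proof (pos_INR K). pose proof (frac_pos 1 (INR K + 2)).
  destruct decP; [|lra]. unfold Rdiv in *. lra.
Qed.

Lemma pot_good th i v K : (i <= length P)%nat -> I v -> good P (i, v) ->
  pot th (mk (R0 + i) v K) = if Rle_dec (2 / (INR K + 1)) th then 1 / (INR K + 2) else th.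
Proof.
  intros Hi Hv Hg. unfold pot. rewrite nth_mark_1, nth_mark_0 by (auto using control_pc).
  rewrite ind_neq by lia. simpl. destruct Rle_dec; [|lra].
  rewrite decP_true; [easy|]. exists i, v, K; auto.
Qed.

Lemma pot_0 th v K : I v ->
  pot th (mk 0 v K) = if Rle_dec (2 / (INR K + 1)) th then 1 else th.
Proof.
  intros Hv. unfold pot. rewrite nth_mark_1, nth_mark_0 by (auto using control_0).
  reflexivity.
Qed.

Lemma pot_nonneg th m : 0 <= th -> 0 <= pot th m.
Proof.
  intros H. unfold pot. pose proof (pos_INR (nth 1 m 0%nat)).
  destruct (Rle_dec _ _); [|lra]. destruct (Nat.eqb _ _); [|lra].
  destruct (decP _); left; apply frac_pos; lra.
Qed.

Lemma convex_le (d a b c : R) : 0 <= d <= 1 -> a <= c -> b <= c -> (1 - d) * a + d * b <= c.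
Proof. intros; nra. Qed.

Lemma gstep_pc_le i v i' v' : gstep P (i, v) = Some (i', v') -> (i' <= length P)%nat.
Proof.
  simpl. destruct (nth_error P i) as [ins|] eqn:E; [|easy].
  destruct (wf_nth P R0 HP i ins E) as [Hw _].
  destruct ins as [l j|r l j1 j0|]; simpl in Hw; [| |easy].
  - intros [= <- _]; tauto.
  - destruct (v r); intros [= <- _]; tauto.
Qed.

Section Halting.
Hypothesis restart_good : forall v, I v -> good P (0%nat, v).

Lemma pot_restart th v K : I v ->
  pot th (mk R0 v K) = if Rle_dec (2 / (INR K + 1)) th then 1 / (INR K + 2) else th.
Proof.
  intros Hv. rewrite <- (Nat.add_0_r R0) at 2. apply pot_good; auto. lia.
Qed.

Lemma cheat_prob_le_1 K eps : eps <= / ((INR K + 2) * (INR K + 3)) -> eps <= 1.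
Proof.
  intros H. pose proof (pos_INR K). eapply Rle_trans; [exact H|].
  rewrite <- Rinv_1. apply Rinv_le_contravar; nra.
Qed.

(** While 2/(K+1) exceeds [th] the potential is the constant [th]; when the counter crosses this
    threshold, the successors average at most 2/(K+2), which is then at most [th]. Past the
    threshold, the factor 2 of the other markings pays for the chance of a detection at the flag. *)
Lemma pot_expect th m : 0 < th -> reachable N m ->
  ~ (nth 0 m 0%nat <> 0%nat /\ 2 / (INR (nth 1 m 0%nat) + 1) <= th) ->
  expect N m (pot th) <= pot th m.
Proof.
  intros Hth Hm HX.
  destruct (reachable_invariant m Hm) as (q0 & v1 & K & Em & Hq0 & Hv1).
  pose proof (pos_INR K) as HK.
  assert (Hd : 2 / (INR K + 1 + 2) <= 2 / (INR K + 1 + 1)) by (apply frac_decr; lra).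
  assert (Hd2 : 2 / (INR K + 1 + 1) <= 2 / (INR K + 1)) by (apply frac_decr; lra).
  assert (Hd3 : / (INR K + 2) + 1 / (INR K + 1 + 2) <= 2 / (INR K + 2)).
  { pose proof (frac_decr 1 (INR K + 2) (INR K + 1 + 2)). unfold Rdiv in *. lra. }
  assert (Hdelta : 0 <= / (INR K + 2) <= 1).
  { split; [left; apply Rinv_0_lt_compat; lra|]. rewrite <- Rinv_1.
    apply Rinv_le_contravar; lra. }
  assert (Hdelta' : 0 < 1 / (INR K + 1 + 2)) by (apply frac_pos; lra).
  destruct (decP_spec (good_marking m)) as [[Hg _]|[Hg _]].
  - destruct Hg as (i & v & K' & Em' & Hv & Hi & Hg).
    assert (K' = K) as ->.
    { assert (HK' : nth 1 m 0%nat = K') by (rewrite Em'; apply nth_mark_1; auto using control_pc).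
      rewrite <- HK', Em. apply nth_mark_1; auto. }
    clear Em. subst m. rewrite (pot_good th i v K) by auto.
    destruct (pc_cases i v Hi) as [-> | [Hf | [[i' v'] Hs]]].
    + rewrite expect_halt by auto. rewrite (pot_good th _ v K) by auto. lra.
    + now apply (flag_not_good P i v) in Hf.
    + destruct (step_machine P R0 v0 HR HP i v K i' v' Hs (I_wf _ Hv))
        as (eps & jb & He & Hjb & -> & _).
      pose proof (cheat_prob_le_1 K eps (proj2 He)) as He1.
      pose proof (pot_pc th jb v (S K) Hjb Hv) as Hbad.
      rewrite (pot_good th i' v' (S K)) by
        (eauto using gstep_pc_le; now apply (good_step P (i, v))).
      rewrite S_INR in *. destruct (Rle_dec (2 / (INR K + 1)) th);
        destruct (Rle_dec (2 / (INR K + 1 + 1)) th); try lra.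
      * assert (Hk : eps * (INR K + 2) * (INR K + 3) <= 1).
        { destruct He as [_ He]. apply (Rmult_le_compat_r ((INR K + 2) * (INR K + 3))) in He; [|nra].
          rewrite Rinv_l in He by nra. lra. }
        assert (eps * (INR K + 2) <= 1) by nra.
        (* The honest successor is good and has potential 1/(K+3), the cheat leads to at most
           2/(K+3). Their average (1 + eps)/(K+3) is at most 1/(K+2) exactly when eps (K+2) <= 1. *)
        apply Rle_trans with ((1 - eps) * (1 / (INR K + 1 + 2)) + eps * (2 / (INR K + 1 + 2))).
        { apply Rplus_le_compat_l, Rmult_le_compat_l; lra. }
        replace ((1 - eps) * (1 / (INR K + 1 + 2)) + eps * (2 / (INR K + 1 + 2)))
          with ((1 + eps) / (INR K + 1 + 2)) by (field; lra).
        apply Rmult_le_reg_r with ((INR K + 1 + 2) * (INR K + 2)); [nra|].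
        field_simplify; [nra|lra|lra].
      * apply convex_le; [lra| |lra].
        apply Rle_trans with (2 / (INR K + 1 + 2)); [|lra]. unfold Rdiv in *; lra.
      * apply convex_le; lra.
  - subst m. rewrite nth_mark_1 in HX by auto. rewrite nth_mark_0 in HX by auto.
    destruct (control_cases q0 Hq0) as [-> | (i & -> & Hi)].
    + simpl in HX. destruct (step_detected P R0 v0 HR HP v1 K (pot th) (I_wf _ Hv1)) as [-> _].
      rewrite pot_0, pot_restart by auto. rewrite S_INR.
      destruct (Rle_dec (2 / (INR K + 1)) th); [exfalso; apply HX; split; [easy|auto]|].
      destruct (Rle_dec (2 / (INR K + 1 + 1)) th); [|lra]. unfold Rdiv in *; lra.
    + assert (Hpot : pot th (mk (R0 + i) v1 K) =
                if Rle_dec (2 / (INR K + 1)) th then 2 / (INR K + 2) else th).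
      { unfold pot. rewrite nth_mark_1, nth_mark_0 by (auto using control_pc).
        rewrite ind_neq by lia. simpl. now rewrite decP_false. }
      rewrite Hpot.
      destruct (pc_cases i v1 Hi) as [-> | [Hf | [[i' v'] Hs]]].
      * rewrite expect_halt by auto. rewrite Hpot. lra.
      * destruct (step_flag P R0 v0 HR HP i v1 K (pot th) Hf (I_wf _ Hv1)) as [-> _].
        rewrite pot_0, pot_restart by auto. rewrite S_INR.
        (* Detection has potential 1 and probability 1/(K+2); otherwise the restarted machine is
           good and has the small potential 1/(K+3). This is where halting of every round enters. *)
        assert ((1 - / (INR K + 2)) * (1 / (INR K + 1 + 2)) + / (INR K + 2) * 1
                <= 2 / (INR K + 2)) by nra.
        assert (2 / (INR K + 2) <= 2 / (INR K + 1 + 1)) by (right; f_equal; ring).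
        destruct (Rle_dec (2 / (INR K + 1)) th);
          destruct (Rle_dec (2 / (INR K + 1 + 1)) th); try lra.
      * destruct (step_machine P R0 v0 HR HP i v1 K i' v' Hs (I_wf _ Hv1))
          as (eps & jb & He & Hjb & -> & _).
        pose proof (cheat_prob_le_1 K eps (proj2 He)) as He1.
        pose proof (pot_pc th jb v1 (S K) Hjb Hv1) as Hbad.
        pose proof (pot_pc th i' v' (S K) (gstep_pc_le _ _ _ _ Hs) (I_step _ _ _ _ Hv1 Hs)) as Hok.
        rewrite S_INR in *.
        assert (2 / (INR K + 1 + 2) <= 2 / (INR K + 2)) by (apply frac_decr; lra).
        destruct (Rle_dec (2 / (INR K + 1)) th);
          destruct (Rle_dec (2 / (INR K + 1 + 1)) th); apply convex_le; lra.
Qed.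

Lemma pot_start th m : nth 0 m 0%nat = 0%nat ->
  2 / (INR (nth 1 m 0%nat) + 1) <= th -> pot th m <= 2 / (INR (nth 1 m 0%nat) + 2).
Proof.
  intros H0 H. unfold pot. rewrite H0. simpl. destruct Rle_dec; [|easy].
  pose proof (pos_INR (nth 1 m 0%nat)). pose proof (frac_pos 1 (INR (nth 1 m 0%nat) + 2)).
  destruct decP; [|lra]. unfold Rdiv in *. lra.
Qed.

Theorem halting_net_divergent :
  computable_real (marking_val true) -> computable_real (marking_val false) -> divergent N.
Proof.
  intros Hc0 Hc1. exists (marking_val true), (marking_val false).
  assert (HV : valid N) by now apply net_valid.
  assert (Hpos : forall b m, 0 <= marking_val b m).
  { intros b m. unfold marking_val. destruct Bool.eqb; [lra|].
    left. apply frac_pos; [lra|]. apply lt_0_INR; lia. }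
  repeat split; auto.
  - intros th [Hth Hth1]. apply PrF_le; [auto|constructor|]. intros k.
    eapply Rle_trans.
    + apply (within_le_supermartingale N HV _ (pot th)); [| | |constructor].
      * intros; apply pot_nonneg; lra.
      * intros m Hm [_ HX]. unfold marking_val, pot in *.
        rewrite S_INR in HX. destruct (Nat.eqb (nth 0 m 0%nat) 0); simpl in HX; [lra|].
        destruct Rle_dec; [lra|easy].
      * intros m Hm HX. apply pot_expect; auto. intros [H1 H2]. apply HX.
        split; [auto|]. unfold marking_val. rewrite S_INR.
        destruct (Nat.eqb_spec (nth 0 m 0%nat) 0); [easy|]. simpl. lra.
    (* The counter starts at 0 and 2/(0+1) exceeds [th], so the initial potential is [th], the bound
       required by clause (a). *)
    + unfold pot. change (pm0 N) with (mk R0 v0 0).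
      rewrite nth_mark_1 by (auto using control_start). simpl.
      destruct Rle_dec; [lra|lra].
  - intros m Hm. destruct (Nat.eqb_spec (nth 0 m 0%nat) 0) as [E|E].
    + apply PrF_le; auto. intros k. eapply Rle_trans.
      (* 2/(K+1) <= 2 always holds, so [pot 2] has no threshold and bounds detection from every
         reachable marking. *)
      * apply (within_le_supermartingale N HV _ (pot 2)); auto.
        -- intros; apply pot_nonneg; lra.
        -- intros m' Hm' HA.
           destruct (reachable_invariant m' Hm') as (q & v & K & -> & Hq & Hv).
           apply inA_mark in HA; auto. subst q. rewrite pot_0 by auto.
           destruct Rle_dec; lra.
        -- intros m' Hm' HA. apply pot_expect; auto; [lra|]. intros [H1 _].
           destruct (reachable_invariant m' Hm') as (q & v & K & -> & Hq & Hv).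
           apply HA, inA_mark; auto. rewrite nth_mark_0 in H1 by auto.
           unfold ind in H1. now destruct q.
      * unfold marking_val. rewrite E, S_INR. simpl. pose proof (pos_INR (nth 1 m 0%nat)).
        eapply Rle_trans; [apply pot_start; auto|].
        -- replace 2 with (2 / 1) at 2 by field. apply frac_decr; lra.
        -- apply frac_decr; lra.
    + unfold marking_val. apply Nat.eqb_neq in E. rewrite E. simpl.
      apply PrF_le; auto. intros k. now apply within_le_1.
  - intros th [Hth Hth1]. destruct reachable_bounded as [B HB].
    destruct (INR_unbounded (2 / th)) as [kmax Hk].
    exists (bounded_lists (np P R0) (list_max (map B (seq 0 kmax)))).
    intros m Hm H0 H1.
    (* At every marking one of the two certificates equals 2/(K+1), so if both are at least [th],
       the counter is below 2/th. *)
    assert (HK : (nth 1 m 0 < kmax)%nat).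
    { assert (Hq : th <= 2 / INR (S (nth 1 m 0%nat))).
      { unfold marking_val in *. destruct (Nat.eqb (nth 0 m 0%nat) 0); simpl in H0, H1; auto. }
      apply INR_lt. rewrite S_INR in Hq. pose proof (pos_INR (nth 1 m 0%nat)).
      apply (Rmult_le_compat_r (INR (nth 1 m 0%nat) + 1)) in Hq; [|lra].
      unfold Rdiv in Hq at 1. rewrite Rmult_assoc, Rinv_l in Hq by lra.
      apply Rmult_gt_compat_r with (r := th) in Hk; [|lra].
      unfold Rdiv in Hk at 1. rewrite Rmult_assoc, Rinv_l in Hk by lra. nra. }
    apply in_bounded_lists.
    + destruct (reachable_invariant m Hm) as (q & v & K & -> & _).
      unfold mark. now rewrite length_map, length_seq.
    + intros x Hx. destruct (In_nth m x 0%nat Hx) as (p & _ & <-).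
      eapply Nat.le_trans; [apply HB; auto|].
      assert (Hall := proj1 (list_max_le (map B (seq 0 kmax)) _) (Nat.le_refl _)).
      rewrite Forall_forall in Hall. apply Hall, in_map, in_seq. lia.
Qed.

End Halting.

(** * Non-divergence of a net whose machine is restarted forever *)

Section Restarting.
Variables (fl n0 len : nat) (v1 : nat -> nat).
Hypothesis Hfl : nth_error P fl = Some FLAG.
Hypothesis Hrun0 : nsteps P n0 (0%nat, v0) = Some (fl, v1).
Hypothesis Hrun1 : nsteps P len (0%nat, v1) = Some (fl, v1).

Lemma I_nsteps n i v i' v' : I v -> nsteps P n (i, v) = Some (i', v') -> I v'.
Proof.
  revert i v; induction n as [|n IH]; simpl; intros i v HI Hn.
  - now injection Hn as _ <-.
  - change (match gstep P (i, v) with Some c' => nsteps P n c' | None => None end = Some (i', v')) in Hn.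
    destruct (gstep P (i, v)) as [[i1 w]|] eqn:E; [|easy]. eauto.
Qed.

(** After a cheat nothing is assumed beyond nonnegativity of the probability. The loss at counter K
    is thus at most 1/(K+2) - 1/(K+3), and the losses of the [n] steps telescope. *)
Lemma within_run X n k K i v i' v' :
  I v -> nsteps P n (i, v) = Some (i', v') -> reachable N (mk (R0 + i) v K) ->
  reachable N (mk (R0 + i') v' (K + n)) /\
  within N X k (mk (R0 + i') v' (K + n)) - (/ (INR K + 2) - / (INR (K + n) + 2))
  <= within N X (n + k) (mk (R0 + i) v K).
Proof.
  assert (HV : valid N) by now apply net_valid.
  revert K i v; induction n as [|n IH]; intros K i v HI Hn Hm.
  - simpl in Hn. injection Hn as <- <-. rewrite Nat.add_0_r. split; [auto|]. simpl. lra.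
  - change (match gstep P (i, v) with Some c' => nsteps P n c' | None => None end = Some (i', v')) in Hn.
    destruct (gstep P (i, v)) as [[i1 w]|] eqn:E; [|easy].
    destruct (step_machine P R0 v0 HR HP i v K i1 w E (I_wf _ HI))
      as (eps & jb & He & Hjb & Hexp & Hreach).
    destruct (Hreach Hm) as [Hm1 Hm2].
    destruct (IH (S K) i1 w (I_step _ _ _ _ HI E) Hn Hm1) as [Hr Hw].
    replace (S K + n)%nat with (K + S n)%nat in Hr, Hw by lia.
    split; [auto|]. change (S n + k)%nat with (S (n + k)). rewrite within_S.
    pose proof (pos_INR K) as HK.
    assert (Hmono : / (INR (K + S n) + 2) <= / (INR K + 2)).
    { apply Rinv_le_contravar; [lra|]. apply Rplus_le_compat_r, le_INR. lia. }
    destruct (decP_spec (X (mk (R0 + i) v K))) as [[HX ->]|[HX ->]].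
    + pose proof (within_le_1 N HV X k _ Hr). lra.
    + rewrite Hexp. rewrite S_INR in Hw.
      pose proof (within_le_1 N HV X (n + k) _ Hm1).
      assert (Hbad : 0 <= eps * within N X (n + k) (mk (R0 + jb) v (S K))).
      (* Nonnegativity of [within] is available only at reachable markings; if no cheat is possible,
         [jb] need not lead to one, but then [eps] is 0. *)
      { destruct Hm2 as [->|Hm2]; [lra|].
        apply Rmult_le_pos; [lra|]. now apply within_ge_0. }
      assert (Heq : / (INR K + 2) - / (INR K + 1 + 2) = / ((INR K + 2) * (INR K + 3))).
      { field. lra. }
      nra.
Qed.

Lemma within_run_start X n k K v i' v' :
  I v -> nsteps P n (0%nat, v) = Some (i', v') -> reachable N (mk R0 v K) ->
  reachable N (mk (R0 + i') v' (K + n)) /\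
  within N X k (mk (R0 + i') v' (K + n)) - (/ (INR K + 2) - / (INR (K + n) + 2))
  <= within N X (n + k) (mk R0 v K).
Proof. generalize (within_run X n k K 0 v i' v'). now rewrite Nat.add_0_r. Qed.

(** Only an inequality, since the flag marking may itself lie in [X]. *)
Lemma within_flag X k K v : I v ->
  reachable N (mk (R0 + fl) v K) ->
  (1 - / (INR K + 2)) * within N X k (mk R0 v (S K)) + / (INR K + 2) * within N X k (mk 0 v (S K))
  <= within N X (S k) (mk (R0 + fl) v K).
Proof.
  assert (HV : valid N) by now apply net_valid.
  intros HI Hm.
  destruct (step_flag P R0 v0 HR HP fl v K (within N X k) Hfl (I_wf _ HI)) as [He Hr].
  destruct (Hr Hm) as [H1 H2].
  rewrite within_S. destruct (decP _); [|lra].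
  pose proof (pos_INR K). apply convex_le; try (now apply within_le_1).
  split; [left; apply Rinv_0_lt_compat; lra|]. rewrite <- Rinv_1. apply Rinv_le_contravar; lra.
Qed.

Lemma I_v1 : I v1.
Proof. eapply I_nsteps; [apply I_init|exact Hrun0]. Qed.

(** Both outcomes at the flag lead to a restart with registers [v1], one of them through place 0, so
    only cheats can keep the counter of faithful restarts from growing past [k0]. *)
Lemma flag_far X k0 j :
  (forall K, (k0 <= K)%nat -> reachable N (mk R0 v1 K) -> X (mk R0 v1 K)) ->
  forall K, (k0 <= K + j)%nat -> reachable N (mk (R0 + fl) v1 K) ->
  exists k, 1 - / (INR K + 2) <= within N X k (mk (R0 + fl) v1 K).
Proof.
  assert (HV : valid N) by now apply net_valid.
  intros HX.
  assert (Hstep : forall K,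
    (forall K', (K < K')%nat -> reachable N (mk R0 v1 K') ->
      exists k, 1 - / (INR K' + 2) <= within N X k (mk R0 v1 K')) ->
    reachable N (mk (R0 + fl) v1 K) ->
    exists k, 1 - / (INR K + 2) <= within N X k (mk (R0 + fl) v1 K)).
  { intros K HK' Hm. pose proof (pos_INR K) as HK.
    destruct (step_flag P R0 v0 HR HP fl v1 K (fun _ => 0) Hfl (I_wf _ I_v1)) as [_ Hr].
    destruct (Hr Hm) as [Hr1 Hr2].
    destruct (step_detected P R0 v0 HR HP v1 (S K) (fun _ => 0) (I_wf _ I_v1)) as [_ Hr3].
    specialize (Hr3 Hr2).
    destruct (HK' (S K) ltac:(lia) Hr1) as [k1 Hk1].
    destruct (HK' (S (S K)) ltac:(lia) Hr3) as [k2 Hk2].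
    assert (Hk2' : 1 - / (INR (S (S K)) + 2) <= within N X (S k2) (mk 0 v1 (S K))).
    { rewrite within_S. destruct (decP _).
      - rewrite !S_INR. pose proof (Rinv_0_lt_compat (INR K + 1 + 1 + 2)). lra.
      - destruct (step_detected P R0 v0 HR HP v1 (S K) (within N X k2) (I_wf _ I_v1)) as [-> _].
        exact Hk2. }
    exists (S (Nat.max k1 (S k2))).
    eapply Rle_trans; [|apply within_flag; auto using I_v1].
    pose proof (within_mono_time N HV X k1 (Nat.max k1 (S k2)) _ (Nat.le_max_l _ _) Hr1).
    pose proof (within_mono_time N HV X (S k2) (Nat.max k1 (S k2)) _ (Nat.le_max_r _ _) Hr2).
    rewrite !S_INR in *.
    assert (/ (INR K + 1 + 2) <= / (INR K + 2)) by (apply Rinv_le_contravar; lra).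
    assert (/ (INR K + 1 + 1 + 2) <= / (INR K + 2)) by (apply Rinv_le_contravar; lra).
    assert (0 < / (INR K + 2)) by (apply Rinv_0_lt_compat; lra).
    assert (/ (INR K + 2) <= 1) by (rewrite <- Rinv_1; apply Rinv_le_contravar; lra).
    set (d := / (INR K + 2)) in *. nra. }
  (* [j] bounds the distance from the counter to [k0]; leaving the flag raises the counter, so each
     round consumes at least one unit of it. *)
  induction j as [|j IH]; intros K Hj Hm; apply Hstep; auto; intros K' HK' Hm';
    pose proof (pos_INR K'); assert (0 < / (INR K' + 2)) by (apply Rinv_0_lt_compat; lra).
  - exists 0%nat. rewrite within_in; [lra|]. apply HX; [lia|auto].
  - destruct (within_run_start X len 0 K' v1 fl v1 I_v1 Hrun1 Hm') as [Hr _].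
    destruct (IH (K' + len)%nat ltac:(lia) Hr) as [k Hk].
    exists (len + k)%nat.
    destruct (within_run_start X len k K' v1 fl v1 I_v1 Hrun1 Hm') as [_ Hw]. lra.
Qed.

(* With x a lower bound of the detection probabilities of j rounds, the j rounds together
   detect with probability at least j x / (1 + j x). *)
Lemma detect_rounds B j : forall K, (K + j * S len <= B)%nat -> reachable N (mk R0 v1 K) ->
  exists k, INR j / (INR B + 2 + INR j) - / (INR K + 2) <= within N (inA N) k (mk R0 v1 K).
Proof.
  assert (HV : valid N) by now apply net_valid.
  pose proof (pos_INR B) as HB.
  induction j as [|j IH]; intros K Hj Hm.
  - exists 0%nat. pose proof (within_ge_0 N HV (inA N) 0 _ Hm).
    pose proof (pos_INR K). assert (0 < / (INR K + 2)) by (apply Rinv_0_lt_compat; lra).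
    simpl INR. unfold Rdiv. rewrite Rmult_0_l. lra.
  - destruct (within_run_start (inA N) len 0 K v1 fl v1 I_v1 Hrun1 Hm) as [Hr _].
    set (K1 := (K + len)%nat) in *.
    destruct (step_flag P R0 v0 HR HP fl v1 K1 (fun _ => 0) Hfl (I_wf _ I_v1)) as [_ Hr1].
    destruct (Hr1 Hr) as [Hr2 Hr3].
    destruct (IH (S K1) ltac:(lia) Hr2) as [k Hk].
    exists (len + S k)%nat.
    destruct (within_run_start (inA N) len (S k) K v1 fl v1 I_v1 Hrun1 Hm) as [_ Hw].
    fold K1 in Hw.
    pose proof (within_flag (inA N) k K1 v1 I_v1 Hr) as Hf.
    rewrite (within_in N (inA N) k (mk 0 v1 (S K1))) in Hf
      by (apply inA_mark; auto using control_0, I_v1).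
    pose proof (pos_INR j) as Hj0. pose proof (pos_INR K1) as HK1.
    assert (HKB : INR K1 <= INR B) by (apply le_INR; lia).
    rewrite !S_INR in *.
    set (h := INR j / (INR B + 2 + INR j)) in *.
    assert (Hh : 0 <= h <= 1).
    { unfold h. split; [apply Rdiv_le_0_compat; lra|].
      apply Rmult_le_reg_r with (INR B + 2 + INR j); [lra|].
      unfold Rdiv. rewrite Rmult_assoc, Rinv_l; lra. }
    (* With x = 1/(B+2), detecting now or else in the [j] later rounds gives h + x (1 - h) =
       (j+1)/(B+2+j), slightly more than the claimed bound for j+1 rounds. *)
    assert (Hh1 : (INR j + 1) / (INR B + 2 + (INR j + 1)) <= h + / (INR B + 2) * (1 - h)).
    { unfold h.
      replace (INR j / (INR B + 2 + INR j) + / (INR B + 2) * (1 - INR j / (INR B + 2 + INR j)))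
        with ((INR j + 1) / (INR B + 2 + INR j)) by (field; lra).
      apply frac_decr; lra. }
    assert (Hd : / (INR B + 2) <= / (INR K1 + 2)) by (apply Rinv_le_contravar; lra).
    assert (Hd0 : 0 < / (INR K1 + 2)) by (apply Rinv_0_lt_compat; lra).
    assert (Hd1 : / (INR K1 + 2) <= 1) by (rewrite <- Rinv_1; apply Rinv_le_contravar; lra).
    assert (Hd2 : / (INR K1 + 1 + 2) <= / (INR K1 + 2)) by (apply Rinv_le_contravar; lra).
    assert (Hd3 : 0 < / (INR K1 + 1 + 2)) by (apply Rinv_0_lt_compat; lra).
    set (d := / (INR K1 + 2)) in *.
    assert ((1 - d) * (h - / (INR K1 + 1 + 2)) <=
            (1 - d) * within N (inA N) k (mk R0 v1 (S K1)))
      by (apply Rmult_le_compat_l; lra).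
    assert (/ (INR B + 2) * (1 - h) <= d * (1 - h)) by (apply Rmult_le_compat_r; lra).
    nra.
Qed.

Lemma detect_prob K : (2 * (len + 3) <= K)%nat -> reachable N (mk R0 v1 K) ->
  / (2 * (INR len + 3)) <= PrF N (inA N) (mk R0 v1 K).
Proof.
  assert (HV : valid N) by now apply net_valid.
  intros HK Hm.
  (* A number of rounds proportional to the counter suffices: with j = K+2 every term of B+2+j is a
     multiple of K+2, and the quotient is 1/(len+3) for all K. The hypothesis on K makes the cheat
     loss at most half of it. *)
  destruct (detect_rounds (K + (K + 2) * S len) (K + 2) K ltac:(lia) Hm) as [k Hk].
  eapply Rle_trans; [|now apply (within_le_PrF N HV _ k)].
  eapply Rle_trans; [|exact Hk].
  apply le_INR in HK. rewrite mult_INR, plus_INR, !S_INR in HK.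
  rewrite !plus_INR, mult_INR, plus_INR, !S_INR. change (INR 0) with 0 in *.
  pose proof (pos_INR len). pose proof (pos_INR K).
  replace ((INR K + (0 + 1 + 1)) / _) with (/ (INR len + 3)) by (field; split; nra).
  assert (/ (INR K + 2) <= / (2 * (INR len + 3))) by (apply Rinv_le_contravar; lra).
  assert (/ (INR len + 3) = / (2 * (INR len + 3)) + / (2 * (INR len + 3))) by (field; lra).
  lra.
Qed.

(** At late faithful restarts clause (b) forces [f1] to be at least [th], so clause (c) makes [f0]
    small at all but finitely many of them. Reaching such a restart has probability at least 1/2,
    against clause (a). *)
Theorem restarting_net_not_divergent : ~ divergent N.
Proof.
  assert (HV : valid N) by now apply net_valid.
  intros (f0 & f1 & _ & _ & Hpos & H0 & H1 & Hfin).
  pose proof (pos_INR len) as Hlen.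
  set (th := / (2 * (INR len + 3))) in *.
  assert (Hth : 0 < th < / 2).
  { unfold th. split; [apply Rinv_0_lt_compat; lra|]. apply Rinv_lt_contravar; lra. }
  destruct (Hfin th ltac:(lra)) as [L HL].
  (* From [k0] on the counter is large enough for [detect_prob] and larger than in any marking of
     [L]. *)
  set (k0 := (2 * (len + 3) + S (list_max (map (fun m => nth 1 m 0%nat) L)))%nat).
  assert (HX : forall K, (k0 <= K)%nat -> reachable N (mk R0 v1 K) -> 0 <= f0 (mk R0 v1 K) <= th).
  { intros K HK Hm. split; [now apply Hpos|].
    apply Rnot_lt_le; intros Hlt.
    assert (Hin : In (mk R0 v1 K) L).
    { apply HL; auto; [lra|]. eapply Rle_trans; [|apply H1; auto].
      apply detect_prob; auto. lia. }
    assert (Hall := proj1 (list_max_le (map (fun m => nth 1 m 0%nat) L) _) (Nat.le_refl _)).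
    rewrite Forall_forall in Hall. specialize (Hall _ (in_map _ _ _ Hin)). simpl in Hall.
    rewrite nth_mark_1 in Hall by (auto using control_start, I_v1). lia. }
  assert (Hm0 : reachable N (mk R0 v0 0)) by constructor.
  destruct (within_run_start (fun m => 0 <= f0 m <= th) n0 0 0 v0 fl v1 I_init Hrun0 Hm0) as [Hr _].
  (* The loss is at most 1/2 - 1/(n0+2) up to the first flag and 1/(n0+2) afterwards; probability
     1/2 remains, which exceeds [th]. *)
  destruct (flag_far (fun m => 0 <= f0 m <= th) k0 k0 HX (0 + n0)%nat ltac:(lia) Hr) as [k Hk].
  destruct (within_run_start (fun m => 0 <= f0 m <= th) n0 k 0 v0 fl v1 I_init Hrun0 Hm0) as [_ Hw].
  assert (Hc := within_le_PrF N HV (fun m => 0 <= f0 m <= th) (n0 + k) (mk R0 v0 0)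
                  ltac:(constructor)).
  specialize (H0 th ltac:(lra)). change (pm0 N) with (mk R0 v0 0) in H0.
  change (INR 0) with 0 in Hw. lra.
Qed.

End Restarting.
End NetBehaviour.

(** * Computability of the certificates *)

Definition halts (prog : list instr) (pc : nat) (regs out : nat -> nat) : Prop :=
  exists fuel, exec prog fuel pc regs = Some out.

Lemma halts_end prog pc regs : nth_error prog pc = None -> halts prog pc regs regs.
Proof. intros H. exists 0%nat. simpl. now rewrite H. Qed.

Lemma halts_inc prog pc r regs out :
  nth_error prog pc = Some (INC r) ->
  halts prog (S pc) (upd regs r (S (regs r))) out -> halts prog pc regs out.
Proof. intros H [fuel Hf]. exists (S fuel). simpl. now rewrite H. Qed.

Lemma halts_dec_S prog pc r j regs k out :
  nth_error prog pc = Some (DEC r j) -> regs r = S k ->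
  halts prog (S pc) (upd regs r k) out -> halts prog pc regs out.
Proof. intros H Hr [fuel Hf]. exists (S fuel). simpl. now rewrite H, Hr. Qed.

Lemma halts_dec_0 prog pc r j regs out :
  nth_error prog pc = Some (DEC r j) -> regs r = 0%nat ->
  halts prog j regs out -> halts prog pc regs out.
Proof. intros H Hr [fuel Hf]. exists (S fuel). simpl. now rewrite H, Hr. Qed.

Ltac upd_solve :=
  unfold upd;
  repeat (match goal with |- context [Nat.eqb ?a ?b] => destruct (Nat.eqb_spec a b) end; try lia);
  subst; try lia; try congruence.
Ltac upd_ext := apply functional_extensionality; intros ?z; upd_solve.

(** * Inverting the Cantor pairing on a counter machine *)

Fixpoint tri (s : nat) : nat := match s with O => 0%nat | S s' => (tri s' + S s')%nat end.

Lemma cpair_tri a b : cpair a b = (tri (a + b) + b)%nat.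
Proof.
  unfold cpair. f_equal. generalize (a + b)%nat as s. intros s.
  assert (H : (s * (s + 1) = tri s * 2)%nat) by (induction s; simpl; lia).
  now rewrite H, Nat.div_mul.
Qed.

(* The successor in the Cantor enumeration of pairs. *)
Definition next_pair (pq : nat * nat) : nat * nat :=
  match pq with
  | (O, q) => (S q, O)
  | (S p, q) => (p, S q)
  end.

Fixpoint walk (n : nat) (pq : nat * nat) : nat * nat :=
  match n with O => pq | S n' => walk n' (next_pair pq) end.

Lemma walk_S n pq : walk (S n) pq = next_pair (walk n pq).
Proof. revert pq; induction n as [|n IH]; intros pq; [easy|]. simpl. now rewrite <- IH. Qed.

(** The first [tri s] steps exhaust the diagonals with sum below [s]; [b] further steps go along
    diagonal [s]. *)
Lemma walk_cpair a b : walk (cpair a b) (0, 0)%nat = (a, b).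
Proof.
  rewrite cpair_tri.
  assert (H : forall s b, (b <= s)%nat -> walk (tri s + b) (0, 0)%nat = (s - b, b)%nat).
  { induction s as [|s IHs].
    - intros b' Hb. now replace b' with 0%nat by lia.
    - intros b'; induction b' as [|b' IHb]; intros Hb.
      + replace (tri (S s) + 0)%nat with (S (tri s + s)) by (simpl; lia).
        rewrite walk_S, IHs by lia. now rewrite Nat.sub_diag.
      + rewrite Nat.add_succ_r, walk_S, IHb by lia.
        replace (S s - b')%nat with (S (S s - S b')) by lia. reflexivity. }
  rewrite H by lia. f_equal; lia.
Qed.

(* Register 6 stays 0, so that [DEC 6 j] is a jump to [j]. *)
Definition unpair_code (b c x y : nat) : list instr :=
  [DEC c (b + 9); DEC x (b + 4); INC y; DEC 6 b; DEC y (b + 7); INC x; DEC 6 (b + 4);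
   INC x; DEC 6 b]%nat.

Section Unpair.
Variables (prog : list instr) (b c x y : nat) (f out : nat -> nat).
Hypothesis Hcode : forall i ins,
  nth_error (unpair_code b c x y) i = Some ins -> nth_error prog (i + b) = Some ins.
Hypothesis Hdist : c <> x /\ c <> y /\ x <> y /\ c <> 6%nat /\ x <> 6%nat /\ y <> 6%nat.
Hypothesis Hf6 : f 6%nat = 0%nat.

Let st (n p q : nat) : nat -> nat := upd (upd (upd f c n) x p) y q.

Lemma unpair_move n p q :
  halts prog (7 + b) (st n (p + q) 0) out -> halts prog (4 + b) (st n p q) out.
Proof.
  revert p; induction q as [|q IH]; intros p H.
  - eapply halts_dec_0; [apply (Hcode 4); reflexivity| |].
    + unfold st; upd_solve.
    + rewrite Nat.add_0_r in H. now rewrite (Nat.add_comm b 7).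
  - eapply halts_dec_S; [apply (Hcode 4); reflexivity|unfold st; upd_solve; reflexivity|].
    eapply halts_inc; [apply (Hcode 5); reflexivity|].
    eapply halts_dec_0; [apply (Hcode 6); reflexivity|unfold st; upd_solve|].
    rewrite (Nat.add_comm b 4).
    match goal with |- halts _ _ ?s _ => replace s with (st n (S p) q) end.
    + apply IH. now replace (S p + q)%nat with (p + S q)%nat by lia.
    + unfold st. upd_ext.
Qed.

(** Register [c] holds the number of steps still to walk: a code is unpaired by walking that many
    steps through the enumeration. *)
Lemma unpair_loop n p q :
  halts prog (9 + b) (st 0 (fst (walk n (p, q))) (snd (walk n (p, q)))) out ->
  halts prog b (st n p q) out.
Proof.
  revert p q; induction n as [|n IH]; intros p q H.
  - eapply halts_dec_0; [apply (Hcode 0); reflexivity|unfold st; upd_solve|].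
    now rewrite (Nat.add_comm b 9).
  - eapply halts_dec_S; [apply (Hcode 0); reflexivity|unfold st; upd_solve; reflexivity|].
    match goal with |- halts _ _ ?s _ => replace s with (st n p q) by (unfold st; upd_ext) end.
    destruct p as [|p]; cbn [walk next_pair] in H; specialize (IH _ _ H).
    + eapply halts_dec_0; [apply (Hcode 1); reflexivity|unfold st; upd_solve|].
      rewrite (Nat.add_comm b 4). apply unpair_move.
      eapply halts_inc; [apply (Hcode 7); reflexivity|].
      eapply halts_dec_0; [apply (Hcode 8); reflexivity|unfold st; upd_solve|].
      match goal with |- halts _ _ ?s _ => replace s with (st n (S q) 0) end; [easy|].
      unfold st. upd_ext.
    + eapply halts_dec_S; [apply (Hcode 1); reflexivity|unfold st; upd_solve; reflexivity|].
      eapply halts_inc; [apply (Hcode 2); reflexivity|].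
      eapply halts_dec_0; [apply (Hcode 3); reflexivity|unfold st; upd_solve|].
      match goal with |- halts _ _ ?s _ => replace s with (st n p (S q)) end; [easy|].
      unfold st. upd_ext.
Qed.

End Unpair.

(** The certificates are rational and computed exactly, so the precision in register 1 is erased
    first. Address 22 tests place 0, address 24 outputs 1, address 26 outputs 2/(K+1), and 31 is the
    end. Decrementing a list code strips the successor of a cons; a list that is too short jumps to
    22 with missing entries 0, as [nth] has it. *)
Definition marking_val_prog (b : bool) : list instr :=
  [DEC 1 2; DEC 6 0; DEC 0 22] ++ unpair_code 3 0 2 3 ++ [DEC 3 22] ++ unpair_code 13 3 4 5 ++
  [DEC 2 (if b then 24 else 26); DEC 6 (if b then 26 else 24);
   INC 0; DEC 6 31;
   INC 0; INC 0; DEC 4 31; INC 1; DEC 6 28]%nat.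

Lemma marking_val_tail b g (a K : nat) :
  g 0%nat = 0%nat -> g 1%nat = 0%nat -> g 2%nat = a -> g 4%nat = K -> g 6%nat = 0%nat ->
  exists out, halts (marking_val_prog b) 22 g out /\
    INR (out 0%nat) / INR (S (out 1%nat)) =
    if Bool.eqb (Nat.eqb a 0) b then 1 else 2 / INR (S K).
Proof.
  intros H0 H1 H2 H4 H6.
  assert (Hone : forall g, g 0%nat = 0%nat -> g 1%nat = 0%nat -> g 6%nat = 0%nat ->
    exists out, halts (marking_val_prog b) 24 g out /\ INR (out 0%nat) / INR (S (out 1%nat)) = 1).
  { clear. intros g H0 H1 H6. exists (upd g 0 1). split.
    - eapply halts_inc; [reflexivity|]. rewrite H0.
      eapply halts_dec_0; [reflexivity|exact H6|]. now apply halts_end.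
    - unfold upd; simpl. rewrite H1. simpl. field. }
  assert (Hloop : forall k g, g 4%nat = k -> g 6%nat = 0%nat ->
    exists out, halts (marking_val_prog b) 28 g out /\
      out 0%nat = g 0%nat /\ out 1%nat = (g 1 + k)%nat).
  { clear. induction k as [|k IH]; intros g H4 H6.
    - exists g. split; [|split; auto; lia].
      eapply halts_dec_0; [reflexivity|exact H4|]. now apply halts_end.
    - destruct (IH (upd (upd g 4 k) 1 (S (upd g 4 k 1)))) as (out & Ho & E0 & E1); auto.
      exists out. split; [|rewrite E0, E1; unfold upd; simpl; split; [auto|lia]].
      eapply halts_dec_S; [reflexivity|exact H4|].
      eapply halts_inc; [reflexivity|].
      now eapply halts_dec_0; [reflexivity|exact H6|]. }
  assert (Hfrac : forall g, g 0%nat = 0%nat -> g 1%nat = 0%nat -> g 4%nat = K -> g 6%nat = 0%nat ->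
    exists out, halts (marking_val_prog b) 26 g out /\
      INR (out 0%nat) / INR (S (out 1%nat)) = 2 / INR (S K)).
  { clear - Hloop. intros g H0 H1 H4 H6.
    destruct (Hloop K (upd (upd g 0 1) 0 2)) as (out & Ho & E0 & E1); auto.
    exists out. split.
    - eapply halts_inc; [reflexivity|]. eapply halts_inc; [reflexivity|].
      unfold upd at 3. rewrite H0. exact Ho.
    - rewrite E0, E1. unfold upd. simpl (_ =? _)%nat. cbv iota. rewrite H1. reflexivity. }
  destruct a as [|a]; simpl Nat.eqb.
  - assert (Hgo : forall out, halts (marking_val_prog b) (if b then 24 else 26)%nat g out ->
                          halts (marking_val_prog b) 22 g out).
    { intros out H. eapply halts_dec_0; [reflexivity|exact H2|exact H]. }
    destruct b; simpl Bool.eqb; cbv iota.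
    + destruct (Hone g) as (out & Ho & E); eauto.
    + destruct (Hfrac g) as (out & Ho & E); eauto.
  - set (g' := upd g 2 a).
    assert (Hgo : forall out, halts (marking_val_prog b) (if b then 26 else 24)%nat g' out ->
                          halts (marking_val_prog b) 22 g out).
    { intros out H. eapply halts_dec_S; [reflexivity|exact H2|].
      eapply halts_dec_0; [reflexivity|exact H6|exact H]. }
    destruct b; simpl Bool.eqb; cbv iota.
    + destruct (Hfrac g') as (out & Ho & E); eauto.
    + destruct (Hone g') as (out & Ho & E); eauto.
Qed.

Lemma marking_val_computable b : computable_real (marking_val b).
Proof.
  exists (marking_val_prog b). intros m k.
  set (a := nth 0 m 0%nat). set (K := nth 1 m 0%nat).
  assert (Hmain : exists out, halts (marking_val_prog b) 0 (init [enc_nats m; k]) out /\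
     INR (out 0%nat) / INR (S (out 1%nat)) = marking_val b m).
  2: { destruct Hmain as (out & [fuel Hf] & E). exists fuel, out. split; [exact Hf|].
       rewrite E, Rminus_diag_eq, Rabs_R0 by reflexivity.
       left. apply Rinv_0_lt_compat, pow_lt; lra. }
  set (z := fun _ : nat => 0%nat).
  assert (Hclear : forall out, halts (marking_val_prog b) 2 (upd z 0 (enc_nats m)) out ->
            halts (marking_val_prog b) 0 (init [enc_nats m; k]) out).
  { intros out H.
    replace (init [enc_nats m; k]) with (upd (upd z 0 (enc_nats m)) 1 k).
    2: { apply functional_extensionality. now intros [|[|[|x]]]. }
    induction k as [|k IH].
    - eapply halts_dec_0; [reflexivity|reflexivity|].
      replace (upd (upd z 0 (enc_nats m)) 1 0) with (upd z 0 (enc_nats m)); [exact H|].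
      subst z. upd_ext.
    - eapply halts_dec_S; [reflexivity|reflexivity|].
      eapply halts_dec_0; [reflexivity|reflexivity|].
      replace (upd (upd (upd z 0 (enc_nats m)) 1 (S k)) 1 k)
        with (upd (upd z 0 (enc_nats m)) 1 k); [exact IH|]. upd_ext. }
  unfold marking_val. fold a K.
  destruct m as [|a' m].
  - destruct (marking_val_tail b (upd z 0 0) a K) as (out & Ho & E); try reflexivity.
    exists out. split; [|exact E]. apply Hclear.
    eapply halts_dec_0; [reflexivity|reflexivity|exact Ho].
  - change (enc_nats (a' :: m)) with (S (cpair a (enc_nats m))) in *.
    set (g1 := upd (upd z 2 a) 3 (enc_nats m)).
    assert (H1 : forall out, halts (marking_val_prog b) 12 g1 out ->
       halts (marking_val_prog b) 2 (upd z 0 (S (cpair a (enc_nats m)))) out).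
    { intros out H. eapply halts_dec_S; [reflexivity|reflexivity|].
      replace (upd (upd z 0 (S (cpair a (enc_nats m)))) 0 (cpair a (enc_nats m)))
        with (upd (upd (upd z 0 (cpair a (enc_nats m))) 2 0) 3 0) by (subst z; upd_ext).
      apply unpair_loop.
      - intros i ins. do 9 (destruct i as [|i]; [auto|]). now destruct i.
      - lia.
      - reflexivity.
      - rewrite walk_cpair. cbn [fst snd].
        replace (upd (upd (upd z 0 0) 2 a) 3 (enc_nats m)) with g1 by (subst g1 z; upd_ext).
        exact H. }
    destruct m as [|K' m].
    + destruct (marking_val_tail b g1 a K) as (out & Ho & E); try reflexivity.
      exists out. split; [|exact E]. apply Hclear, H1.
      eapply halts_dec_0; [reflexivity|reflexivity|exact Ho].
    + set (r := enc_nats m) in *. change (enc_nats (K' :: m)) with (S (cpair K r)) in *.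
      destruct (marking_val_tail b (upd (upd (upd z 2 a) 4 K) 5 r) a K)
        as (out & Ho & E); try reflexivity.
      exists out. split; [|exact E]. apply Hclear, H1.
      eapply halts_dec_S; [reflexivity|reflexivity|].
      replace (upd g1 3 (cpair K r))
        with (upd (upd (upd (upd z 2 a) 3 (cpair K r)) 4 0) 5 0) by (subst g1 z; upd_ext).
      apply unpair_loop.
      * intros i ins. do 9 (destruct i as [|i]; [auto|]). now destruct i.
      * lia.
      * reflexivity.
      * rewrite walk_cpair. cbn [fst snd].
        replace (upd (upd (upd (upd z 2 a) 3 0) 4 K) 5 r)
          with (upd (upd (upd z 2 a) 4 K) 5 r) by (subst z; upd_ext).
        exact Ho.
Qed.

(** * Machine code *)

Open Scope nat_scope.

Definition code := nat -> list ginstr.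

Definition seqc (c1 c2 : code) : code := fun b => c1 b ++ c2 (b + length (c1 b)).

Definition embedded (P : list ginstr) (b : nat) (Q : list ginstr) : Prop :=
  forall i ins, nth_error Q i = Some ins -> nth_error P (b + i) = Some ins.

(** The quantifiers over the base address and the surrounding program let specifications be chained
    by [runs_seq]. *)
Definition runs (c : code) (v v' : nat -> nat) : Prop :=
  forall P b, embedded P b (c b) ->
  exists n, nsteps P n (b, v) = Some (b + length (c b), v').

Lemma embedded_app P b Q1 Q2 :
  embedded P b (Q1 ++ Q2) -> embedded P b Q1 /\ embedded P (b + length Q1) Q2.
Proof.
  intros H. split; intros i ins Hi.
  - apply H. rewrite nth_error_app1; [auto|]. apply nth_error_Some. congruence.
  - rewrite <- Nat.add_assoc. apply H. rewrite nth_error_app2 by lia.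
    now rewrite Nat.add_comm, Nat.add_sub.
Qed.

Lemma runs_seq c1 c2 v v' v'' : runs c1 v v' -> runs c2 v' v'' -> runs (seqc c1 c2) v v''.
Proof.
  intros H1 H2 P b Hc. apply embedded_app in Hc as [Hc1 Hc2].
  destruct (H1 P b Hc1) as [n1 Hn1]. destruct (H2 P _ Hc2) as [n2 Hn2].
  exists (n1 + n2). rewrite (nsteps_add _ _ _ _ _ Hn1), Hn2.
  unfold seqc. now rewrite length_app, Nat.add_assoc.
Qed.

Lemma runs_eq c v v' v'' : runs c v v' -> v' = v'' -> runs c v v''.
Proof. now intros H <-. Qed.

Lemma upd_ind v r k p : v r = S k -> upd v r k p + ind p r = v p.
Proof. intros H. unfold upd, ind. destruct (Nat.eqb_spec p r) as [->|]; lia. Qed.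

Definition xferred (r : nat) (l : list nat) (v : nat -> nat) : nat -> nat :=
  fun p => if Nat.eqb p r then 0 else v p + cnt p l * v r.

Lemma loop_steps P a r l e v :
  nth_error P a = Some (TEST r l a e) -> ~ In r l ->
  exists n, nsteps P n (a, v) = Some (e, xferred r l v).
Proof.
  intros Ha Hr. remember (v r) as k eqn:Hk. symmetry in Hk. revert v Hk.
  induction k as [|k IH]; intros v Hk.
  - exists 1. simpl. rewrite Ha, Hk. do 2 f_equal.
    apply functional_extensionality; intros p. unfold xferred. rewrite Hk.
    destruct (Nat.eqb_spec p r) as [->|]; lia.
  - destruct (IH (addl l (upd v r k))) as [n Hn].
    { unfold addl, upd. rewrite Nat.eqb_refl, cnt_notin by auto. lia. }
    exists (S n). simpl. rewrite Ha, Hk, Hn. do 2 f_equal.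
    apply functional_extensionality; intros p. unfold xferred, addl, upd.
    rewrite Nat.eqb_refl, (cnt_notin r) by auto. rewrite Hk.
    destruct (Nat.eqb p r); lia.
Qed.

Definition xfer (r : nat) (l : list nat) : code := fun b => [TEST r l b (b + 1)].
Definition incr (r : nat) : code := fun b => [ADD [r] (b + 1)].

Lemma runs_xfer r l v : ~ In r l -> runs (xfer r l) v (xferred r l v).
Proof.
  intros Hr P b Hc. apply loop_steps; auto.
  specialize (Hc 0 _ eq_refl). now rewrite Nat.add_0_r in Hc.
Qed.

Lemma runs_incr r v : runs (incr r) v (addl [r] v).
Proof.
  intros P b Hc. exists 1. specialize (Hc 0 _ eq_refl). rewrite Nat.add_0_r in Hc.
  cbn -[Nat.add]. now rewrite Hc.
Qed.

(* Adds the s-th triangular number to register 12, where s is the content of register 10: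
   each round adds the current s to registers 11 and 12 and copies s - 1 back. *)
Definition tric : code := fun b =>
  [TEST 10 [11; 12] b (b + 1); TEST 11 [] (b + 2) (b + 3); TEST 11 [10] (b + 2) b].

Lemma runs_tric s v : v 10 = s -> v 11 = 0 ->
  runs tric v (upd (upd v 10 0) 12 (v 12 + tri s)).
Proof.
  intros Hs Hu P b Hc.
  assert (H0 := Hc 0 _ eq_refl). assert (H1 := Hc 1 _ eq_refl). assert (H2 := Hc 2 _ eq_refl).
  rewrite Nat.add_0_r in H0. clear Hc. change (length (tric b)) with 3.
  revert v Hs Hu; induction s as [|s IH]; intros v Hs Hu;
    (destruct (loop_steps P b 10 [11; 12] (b + 1) v H0) as [n1 Hn1]; [simpl; lia|]).
  - exists (n1 + 1). rewrite (nsteps_add _ _ _ _ _ Hn1). cbn -[Nat.add tri].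
    rewrite H1. unfold xferred at 1. cbn -[Nat.add tri]. rewrite Hu, Hs. cbn -[tri].
    do 2 f_equal. apply functional_extensionality; intros p.
    unfold xferred, upd. rewrite Hs. simpl tri.
    destruct (Nat.eqb_spec p 12) as [->|]; [simpl; lia|].
    destruct (Nat.eqb_spec p 10); lia.
  - set (w := upd (xferred 10 [11; 12] v) 11 s).
    destruct (loop_steps P (b + 2) 11 [10] b w H2) as [n2 Hn2]; [simpl; lia|].
    destruct (IH (xferred 11 [10] w)) as [n3 Hn3].
    { unfold xferred, w, upd. simpl. lia. }
    { reflexivity. }
    exists (n1 + (1 + (n2 + n3))). rewrite (nsteps_add _ _ _ _ _ Hn1).
    erewrite (nsteps_add P 1).
    2: { cbn -[Nat.add xferred]. rewrite H1.
         replace (xferred 10 [11; 12] v 11) with (S s) by (unfold xferred; simpl; lia).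
         rewrite addl_nil. fold w. reflexivity. }
    rewrite (nsteps_add _ _ _ _ _ Hn2), Hn3. do 2 f_equal.
    apply functional_extensionality; intros p. unfold w, xferred, upd. rewrite Hs.
    cbn -[Nat.add Nat.mul tri Nat.eqb cnt].
    destruct (Nat.eqb_spec p 12) as [->|H12]; [simpl; lia|].
    destruct (Nat.eqb_spec p 10) as [->|H10]; [auto|].
    destruct (Nat.eqb_spec p 11) as [->|H11]; [simpl; lia|].
    simpl. rewrite !ind_neq by auto. lia.
Qed.

(** Reading a register empties it; register [i + 4] is the buffer from which input [i] is
    refilled. *)
Definition load (i : nat) (l : list nat) : code := seqc (xfer i (i + 4 :: l)) (xfer (i + 4) [i]).

(** [cpair a b = tri (a + b) + b]: both components are summed in register 10, and the second one is
    also put in register 12, where [tric] adds the triangular number. *)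
Definition combine_acc (la : list nat) : code :=
  seqc (xfer 13 la) (seqc tric (xfer 12 [13])).

(* Register 13 becomes [cpair] of input [i] and register 13, in that order for [pair_left]
   and in the other order for [pair_right]. *)
Definition pair_left (i : nat) : code := seqc (load i [10]) (combine_acc [10; 12]).
Definition pair_right (i : nat) : code := seqc (load i [10; 12]) (combine_acc [10]).

Fixpoint clear (l : list nat) : code :=
  match l with
  | [] => fun _ => []
  | r :: l' => seqc (xfer r []) (clear l')
  end.

Lemma runs_clear l v :
  runs (clear l) v (fun p => if in_dec Nat.eq_dec p l then 0 else v p).
Proof.
  revert v; induction l as [|r l IH]; intros v.
  - intros P b _. exists 0. simpl. now rewrite Nat.add_0_r.
  - eapply runs_eq; [eapply runs_seq; [apply runs_xfer; auto|apply IH]|].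
    apply functional_extensionality; intros p. unfold xferred.
    destruct (Nat.eqb_spec p r) as [->|Hne].
    + destruct (in_dec Nat.eq_dec r (r :: l)) as [_|H]; [now destruct in_dec|].
      exfalso; apply H; now left.
    + destruct (in_dec Nat.eq_dec p l) as [H1|H1], (in_dec Nat.eq_dec p (r :: l)) as [H2|H2];
        simpl in *; try lia; exfalso; intuition congruence.
Qed.

Definition restore : code :=
  seqc (xfer 6 [2]) (seqc (xfer 7 [3]) (seqc (xfer 8 [4]) (xfer 9 [5]))).

(* Computes, in register 13, the code of the net from its number of places, its transitions,
   its minimal elements and the marking of its places from 6 on. *)
Definition quine : code :=
  seqc (load 5 [13]) (
  seqc (pair_left 5) (seqc (incr 13) (
  seqc (pair_left 4) (seqc (incr 13) (
  seqc (pair_left 3) (seqc (incr 13) (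
  seqc (pair_left 2) (seqc (incr 13) (
  seqc (combine_acc [10; 12]) (seqc (incr 13) (
  seqc (combine_acc [10; 12]) (seqc (incr 13) (
  seqc (pair_right 4) (seqc (pair_left 3) (pair_left 2))))))))))))))).

Section Inputs.
Variables k2 k3 k4 k5 : nat.

Definition clean (x : nat) : nat -> nat := fun p =>
  match p with 2 => k2 | 3 => k3 | 4 => k4 | 5 => k5 | 13 => x | _ => 0 end.

Ltac by_places :=
  apply functional_extensionality; intros p; cbn [Nat.add];
  do 14 (destruct p as [|p]; [cbv -[Nat.add Nat.mul tri cpair]; rewrite ?cpair_tri; lia|]);
  cbv -[Nat.add Nat.mul tri cpair]; lia.

Lemma runs_load i l v : ~ In i (i + 4 :: l) -> ~ In (i + 4) [i] ->
  runs (load i l) v (xferred (i + 4) [i] (xferred i (i + 4 :: l) v)).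
Proof. intros H1 H2. eapply runs_seq; now apply runs_xfer. Qed.

Lemma runs_combine_acc la v s a : ~ In 13 la ->
  xferred 13 la v 10 = s -> xferred 13 la v 11 = 0 -> xferred 13 la v 12 = a ->
  runs (combine_acc la) v
    (xferred 12 [13] (upd (upd (xferred 13 la v) 10 0) 12 (a + tri s))).
Proof.
  intros Hla Hs Hu <-. eapply runs_seq; [now apply runs_xfer|].
  eapply runs_seq; [now apply (runs_tric s)|]. apply runs_xfer; simpl; lia.
Qed.

Ltac eval_places := cbn [Nat.add]; cbv -[Nat.add Nat.mul tri cpair]; lia.

Lemma runs_pair_left i x : In i [2; 3; 4; 5] ->
  runs (pair_left i) (clean x) (clean (cpair (clean 0 i) x)).
Proof.
  intros Hi.
  assert (i <> 10 /\ i <> 12) by (simpl in Hi; lia).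
  eapply runs_eq.
  - eapply runs_seq; [apply runs_load; simpl; lia|].
    apply (runs_combine_acc _ _ (clean 0 i + x) x); [simpl; lia|..];
      destruct Hi as [<-|[<-|[<-|[<-|[]]]]]; eval_places.
  - destruct Hi as [<-|[<-|[<-|[<-|[]]]]]; by_places.
Qed.

Lemma runs_pair_right i x : In i [2; 3; 4; 5] ->
  runs (pair_right i) (clean x) (clean (cpair x (clean 0 i))).
Proof.
  intros Hi.
  assert (i <> 10 /\ i <> 12) by (simpl in Hi; lia).
  eapply runs_eq.
  - eapply runs_seq; [apply runs_load; simpl; lia|].
    apply (runs_combine_acc _ _ (x + clean 0 i) (clean 0 i)); [simpl; lia|..];
      destruct Hi as [<-|[<-|[<-|[<-|[]]]]]; eval_places.
  - destruct Hi as [<-|[<-|[<-|[<-|[]]]]]; by_places.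
Qed.

Lemma runs_pair_zero x : runs (combine_acc [10; 12]) (clean x) (clean (cpair 0 x)).
Proof.
  rewrite cpair_tri. eapply runs_eq.
  - apply (runs_combine_acc _ _ x x); [simpl; lia|..]; eval_places.
  - by_places.
Qed.

Lemma runs_incr_acc x : runs (incr 13) (clean x) (clean (S x)).
Proof. eapply runs_eq; [apply runs_incr|]. by_places. Qed.

Lemma runs_load_rest : runs (load 5 [13]) (clean 0) (clean k5).
Proof. eapply runs_eq; [apply runs_load; simpl; lia|]. by_places. Qed.

(** The nested pairs encode the initial marking, which starts with 0, 0, k2, k3, k4, k5. The
    innermost pair has [k5] twice: as the content of place 5 and as the code of all places from 6
    on. No stored number has to contain its own code. *)
Lemma runs_quine :
  runs quine (clean 0)
    (clean (cpair k2 (cpair k3 (cpair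
       (S (cpair 0 (S (cpair 0 (S (cpair k2 (S (cpair k3 (S (cpair k4 (S (cpair k5 k5))))))))))))
       k4)))).
Proof.
  unfold quine.
  eapply runs_seq; [apply runs_load_rest|].
  eapply runs_seq; [apply runs_pair_left; simpl; tauto|].
  eapply runs_seq; [apply runs_incr_acc|].
  eapply runs_seq; [apply runs_pair_left; simpl; tauto|].
  eapply runs_seq; [apply runs_incr_acc|].
  eapply runs_seq; [apply runs_pair_left; simpl; tauto|].
  eapply runs_seq; [apply runs_incr_acc|].
  eapply runs_seq; [apply runs_pair_left; simpl; tauto|].
  eapply runs_seq; [apply runs_incr_acc|].
  eapply runs_seq; [apply runs_pair_zero|].
  eapply runs_seq; [apply runs_incr_acc|].
  eapply runs_seq; [apply runs_pair_zero|].
  eapply runs_seq; [apply runs_incr_acc|].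
  eapply runs_seq; [apply runs_pair_right; simpl; tauto|].
  eapply runs_seq; apply runs_pair_left; simpl; tauto.
Qed.

(* Cheating never changes the sums [v i + v (i + 4)], so the inputs survive every restart. *)
Definition inputs_kept (R0 : nat) (v : nat -> nat) : Prop :=
  wf_regs R0 v /\ v 2 + v 6 = k2 /\ v 3 + v 7 = k3 /\ v 4 + v 8 = k4 /\ v 5 + v 9 = k5.

Lemma clean_inputs_kept R0 x : 13 < R0 -> inputs_kept R0 (clean x).
Proof.
  intros HR. split; [|simpl; lia]. intros p Hp.
  do 14 (destruct p as [|p]; [try lia; reflexivity|]). reflexivity.
Qed.

(** [v] need not come from a faithful run: leftovers lie in the registers from 10 on, and an input
    whose reading was interrupted is split between [i] and [i + 4]. *)
Lemma runs_reset R0 v : 13 < R0 -> inputs_kept R0 v ->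
  runs (seqc (clear (seq 10 (R0 - 10))) restore) v (clean 0).
Proof.
  intros HR (Hwf & H2 & H3 & H4 & H5).
  eapply runs_seq; [apply runs_clear|].
  set (w := fun p => if in_dec Nat.eq_dec p (seq 10 (R0 - 10)) then 0 else v p).
  assert (Hlow : forall p, p < 10 -> w p = v p).
  { intros p Hp. unfold w. destruct in_dec as [H|H]; [|easy]. apply in_seq in H. lia. }
  assert (Hhigh : forall p, 10 <= p -> w p = 0).
  { intros p Hp. unfold w. destruct in_dec as [H|H]; [easy|]. apply Hwf.
    rewrite in_seq in H. lia. }
  assert (H0 : w 0 = 0) by (rewrite Hlow by lia; apply Hwf; lia).
  assert (H1 : w 1 = 0) by (rewrite Hlow by lia; apply Hwf; lia).
  rewrite <- !Hlow in H2, H3, H4, H5 by lia.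
  clearbody w. clear Hlow Hwf v.
  eapply runs_eq.
  - unfold restore. repeat (eapply runs_seq; [apply runs_xfer; simpl; lia|]).
    apply runs_xfer; simpl; lia.
  - apply functional_extensionality; intros p.
    do 10 (destruct p as [|p]; [cbv -[Nat.add Nat.mul]; lia|]).
    assert (Hp := Hhigh (10 + p) ltac:(lia)). cbn -[Nat.mul] in Hp.
    do 4 (destruct p as [|p]; [cbv -[Nat.add Nat.mul]; lia|]).
    cbv -[Nat.add Nat.mul]. lia.
Qed.

(* The register x of the simulated program is register 13 + x. *)
Definition place_regs (g : nat -> nat) : nat -> nat :=
  fun p => if Nat.ltb p 13 then clean 0 p else g (p - 13).

End Inputs.

(** A jump to any address outside the program halts it; [Nat.min] redirects all of them to the end
    of the simulating block. *)
Definition sim_instr (L b k : nat) (ins : instr) : ginstr :=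
  match ins with
  | INC r => ADD [13 + r] (b + S k)
  | DEC r j => TEST (13 + r) [] (b + S k) (b + Nat.min j L)
  end.

Fixpoint sim_from (L b k : nat) (D : list instr) : list ginstr :=
  match D with
  | [] => []
  | ins :: D' => sim_instr L b k ins :: sim_from L b (S k) D'
  end.

Definition sim (D : list instr) : code := fun b => sim_from (length D) b 0 D.

Lemma nth_sim_from L b k D i :
  nth_error (sim_from L b k D) i = option_map (sim_instr L b (k + i)) (nth_error D i).
Proof.
  revert k i; induction D as [|ins D IH]; intros k [|i]; simpl; auto.
  - now rewrite Nat.add_0_r.
  - now rewrite IH, Nat.add_succ_r.
Qed.

Lemma length_sim D b : length (sim D b) = length D.
Proof.
  unfold sim. generalize (length D) at 1, 0. induction D; intros; simpl; auto.
Qed.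

Lemma sim_steps k2 k3 k4 k5 D P b fuel pc g g' :
  embedded P b (sim D b) -> exec D fuel pc g = Some g' ->
  exists n, nsteps P n (b + Nat.min pc (length D), place_regs k2 k3 k4 k5 g) =
            Some (b + length D, place_regs k2 k3 k4 k5 g').
Proof.
  intros Hc. revert pc g; induction fuel as [|fuel IH]; intros pc g He;
    simpl in He; destruct (nth_error D pc) as [ins|] eqn:Hpc; try easy.
  1, 3: injection He as <-; exists 0; simpl; apply nth_error_None in Hpc;
        now rewrite Nat.min_r by lia.
  assert (Hlt : pc < length D) by (apply nth_error_Some; congruence).
  specialize (Hc pc). unfold sim in Hc. rewrite nth_sim_from, Nat.add_0_l, Hpc in Hc.
  specialize (Hc _ eq_refl). rewrite Nat.min_l by lia.
  destruct ins as [r|r j]; cbn [sim_instr] in Hc.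
  - destruct (IH _ _ He) as [n Hn]. rewrite Nat.min_l in Hn by lia.
    exists (S n). cbn [nsteps gstep]. rewrite Hc, <- Hn. do 2 f_equal.
    apply functional_extensionality; intros p. unfold addl, place_regs. simpl cnt.
    destruct (Nat.ltb_spec p 13).
    + rewrite ind_neq; lia.
    + unfold upd. destruct (Nat.eqb_spec (p - 13) r) as [E|E].
      * replace p with (13 + r) by lia. rewrite ind_refl. replace (13 + r - 13) with r by lia. lia.
      * rewrite ind_neq; lia.
  - assert (Hr : place_regs k2 k3 k4 k5 g (13 + r) = g r).
    { unfold place_regs. destruct (Nat.ltb_spec (13 + r) 13); [lia|]. f_equal; lia. }
    destruct (g r) as [|k] eqn:E; destruct (IH _ _ He) as [n Hn].
    + exists (S n). cbn [nsteps gstep]. now rewrite Hc, Hr.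
    + rewrite Nat.min_l in Hn by lia.
      exists (S n). cbn [nsteps gstep]. rewrite Hc, Hr, addl_nil, <- Hn. do 2 f_equal.
      apply functional_extensionality; intros p. unfold upd, place_regs.
      destruct (Nat.ltb_spec p 13), (Nat.eqb_spec p (13 + r)), (Nat.eqb_spec (p - 13) r); auto; lia.
Qed.

(** * The diagonal net *)

Definition instr_reg (ins : instr) : nat := match ins with INC r => r | DEC r _ => r end.

Definition num_regs (D : list instr) : nat := 14 + list_max (map instr_reg D).

(** Register 13 holds the answer. The flag is reached exactly when it is 1; in all other cases
    control goes to [b + 3], which is the end of the machine because this block comes last. *)
Definition verdict : code := fun b =>
  [TEST 13 [] (b + 1) (b + 3); TEST 13 [] (b + 3) (b + 2); FLAG].

Definition machine_code (D : list instr) : code :=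
  seqc (seqc (clear (seq 10 (num_regs D - 10))) restore)
    (seqc quine (seqc (sim D) verdict)).

Definition machine (D : list instr) : list ginstr := machine_code D 0.

(** Beyond [wf_instr] this is a syntactic conservation law: whatever leaves input [i] or its buffer
    [i + 4] returns to one of the two in the same step. *)
Definition ok_instr (R0 M : nat) (ins : ginstr) : Prop :=
  match ins with
  | ADD l j => (forall r, In r l -> 2 <= r < R0) /\ j <= M /\
      forall i, In i [2; 3; 4; 5] -> cnt i l + cnt (i + 4) l = 0
  | TEST r l j1 j0 =>
      2 <= r < R0 /\ (forall r, In r l -> 2 <= r < R0) /\ j1 <= M /\ j0 <= M /\
      forall i, In i [2; 3; 4; 5] -> cnt i l + cnt (i + 4) l = ind i r + ind (i + 4) r
  | FLAG => True
  end.

Definition code_ok (R0 : nat) (c : code) : Prop :=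
  forall b ins, In ins (c b) -> ok_instr R0 (b + length (c b)) ins.

Lemma ok_instr_mono R0 M M' ins : M <= M' -> ok_instr R0 M ins -> ok_instr R0 M' ins.
Proof. intros HM. destruct ins; simpl; [| |auto]; intuition lia. Qed.

Lemma code_ok_seq R0 c1 c2 : code_ok R0 c1 -> code_ok R0 c2 -> code_ok R0 (seqc c1 c2).
Proof.
  intros H1 H2 b ins Hin. unfold seqc in *. rewrite length_app, Nat.add_assoc.
  apply in_app_iff in Hin as [Hin|Hin].
  - eapply ok_instr_mono; [|apply H1, Hin]. lia.
  - now apply H2.
Qed.

Ltac small_code_ok :=
  let b := fresh in let ins := fresh in let H := fresh in
  intros b ins H; simpl in H; repeat destruct H as [<-|H]; try easy;
  simpl; repeat split; try lia; intros; simpl in *;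
  repeat match goal with H : _ \/ _ |- _ => destruct H as [<-|H] end; try easy; try lia.

Lemma clear_ok R0 l : (forall r, In r l -> 10 <= r < R0) -> code_ok R0 (clear l).
Proof.
  induction l as [|r l IH]; intros Hl.
  - intros b ins [].
  - apply code_ok_seq; [|apply IH; intros; apply Hl; now right].
    specialize (Hl r (or_introl eq_refl)). intros b ins [<-|[]]. simpl.
    repeat split; try lia; try easy. intros i Hi. rewrite !ind_neq; lia.
Qed.

Lemma restore_ok R0 : 13 < R0 -> code_ok R0 restore.
Proof. intros HR. unfold restore. repeat apply code_ok_seq; small_code_ok. Qed.

Lemma quine_ok R0 : 13 < R0 -> code_ok R0 quine.
Proof.
  intros HR. unfold quine, pair_left, pair_right, load, combine_acc.
  repeat apply code_ok_seq; small_code_ok.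
Qed.

Lemma verdict_ok R0 : 13 < R0 -> code_ok R0 verdict.
Proof. intros HR. small_code_ok. Qed.

Lemma sim_ok D : code_ok (num_regs D) (sim D).
Proof.
  intros b ins Hin. rewrite length_sim. apply In_nth_error in Hin as [i Hi].
  unfold sim in Hi. rewrite nth_sim_from in Hi.
  destruct (nth_error D i) as [ins0|] eqn:E; [|easy]. injection Hi as <-.
  assert (Hlt : i < length D) by (apply nth_error_Some; congruence).
  assert (Hreg : instr_reg ins0 <= list_max (map instr_reg D)).
  { assert (Hall := proj1 (list_max_le (map instr_reg D) _) (Nat.le_refl _)).
    rewrite Forall_forall in Hall. apply Hall, in_map. eapply nth_error_In; eauto. }
  unfold num_regs. destruct ins0 as [r|r j]; cbn [sim_instr ok_instr instr_reg] in *.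
  - repeat split; try lia.
    + destruct H as [<-|[]]; lia.
    + destruct H as [<-|[]]; lia.
    + intros k Hk. cbn [cnt]. simpl in Hk. rewrite !ind_neq; lia.
  - repeat split; try lia; try easy.
    intros k Hk. cbn [cnt]. simpl in Hk. rewrite !ind_neq; lia.
Qed.

Lemma num_regs_gt D : 13 < num_regs D.
Proof. unfold num_regs; lia. Qed.

Lemma machine_ok D : List.Forall (ok_instr (num_regs D) (length (machine D))) (machine D).
Proof.
  apply Forall_forall. intros ins Hin.
  assert (H : code_ok (num_regs D) (machine_code D)).
  { pose proof (num_regs_gt D).
    assert (code_ok (num_regs D) (clear (seq 10 (num_regs D - 10)))).
    { apply clear_ok. intros r Hr. apply in_seq in Hr. lia. }
    unfold machine_code. auto using code_ok_seq, restore_ok, quine_ok, sim_ok, verdict_ok. }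
  apply (H 0). exact Hin.
Qed.

Lemma machine_wf D : List.Forall (wf_instr (machine D) (num_regs D)) (machine D).
Proof.
  eapply Forall_impl; [|apply machine_ok].
  intros [l j|r l j1 j0|]; simpl; tauto.
Qed.

Lemma inputs_kept_step k2 k3 k4 k5 D v i i' v' :
  inputs_kept k2 k3 k4 k5 (num_regs D) v -> gstep (machine D) (i, v) = Some (i', v') ->
  inputs_kept k2 k3 k4 k5 (num_regs D) v'.
Proof.
  intros (Hwf & H2 & H3 & H4 & H5) Hs. simpl in Hs.
  destruct (nth_error (machine D) i) as [ins|] eqn:E; [|easy].
  assert (Hok := machine_ok D). rewrite Forall_forall in Hok.
  apply nth_error_In in E. specialize (Hok _ E).
  destruct ins as [l j|r l j1 j0|]; simpl in Hok; [| |easy].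
  - injection Hs as <- <-. destruct Hok as (Hl & _ & Hb).
    pose proof (Hb 2) as B2. pose proof (Hb 3) as B3. pose proof (Hb 4) as B4.
    pose proof (Hb 5) as B5. simpl Nat.add in *. unfold addl. split; [|lia].
    intros p Hp. rewrite Hwf, cnt_notin by (auto; intros Hin; specialize (Hl _ Hin); lia). lia.
  - destruct (v r) as [|k] eqn:Er; injection Hs as <- <-; [repeat split; auto|].
    destruct Hok as (Hr & Hl & _ & _ & Hb).
    pose proof (Hb 2) as B2. pose proof (Hb 3) as B3. pose proof (Hb 4) as B4.
    pose proof (Hb 5) as B5. simpl Nat.add in *.
    pose proof (fun p => upd_ind v r k p Er) as Hu.
    unfold addl. split.
    + intros p Hp. rewrite cnt_notin by (intros Hin; specialize (Hl _ Hin); lia).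
      specialize (Hu p). rewrite (Hwf p Hp) in Hu. lia.
    + pose proof (Hu 2). pose proof (Hu 3). pose proof (Hu 4). pose proof (Hu 5).
      pose proof (Hu 6). pose proof (Hu 7). pose proof (Hu 8). pose proof (Hu 9). lia.
Qed.

Section Diagonal.
Variable D : list instr.

Notation R0 := (num_regs D).
Notation P := (machine D).

(** From place 6 on, the initial marking has only the control token at the start [R0], so this tail
    is fixed before the stored numbers are. *)
Definition rest : list nat := map (fun p => ind p R0) (seq 6 (np P R0 - 6)).

Definition in_np : nat := np P R0.
Definition in_trans : nat := enc_list enc_trans (net_trans P R0).
Definition in_min : nat := enc_list enc_nats [vec P R0 [0]].
Definition in_rest : nat := enc_nats rest.

Definition clean_regs : nat -> nat := clean in_np in_trans in_min in_rest 0.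
Definition diag_net : PPN := net P R0 clean_regs.

Lemma enc_diag_net :
  enc_ppn diag_net =
  cpair in_np (cpair in_trans (cpair
    (S (cpair 0 (S (cpair 0 (S (cpair in_np (S (cpair in_trans (S (cpair in_min
       (S (cpair in_rest in_rest)))))))))))) in_min)).
Proof.
  unfold enc_ppn, diag_net; cbn [nplaces ptrans pm0 pAmin net].
  fold in_np in_trans in_min. do 3 f_equal.
  assert (E : mark P R0 R0 clean_regs 0 =
              0 :: 0 :: in_np :: in_trans :: in_min :: in_rest :: rest).
  { unfold mark. assert (Hnp : np P R0 = 6 + (np P R0 - 6)) by (unfold np, num_regs; lia).
    rewrite Hnp at 1. rewrite seq_app, map_app.
    change (seq 0 6) with [0; 1; 2; 3; 4; 5]. cbn [map app].
    match goal with |- context [map ?f (seq (0 + 6) ?n)] => replace (map f (seq (0 + 6) n)) with rest end;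
      [reflexivity|].
    unfold rest. symmetry. apply map_ext_in. intros p Hp. apply in_seq in Hp.
    do 6 (destruct p as [|p]; [lia|]).
    replace (clean_regs (S (S (S (S (S (S p))))))) with 0.
    - rewrite (ind_neq _ 1) by lia. lia.
    - do 8 (destruct p as [|p]; [reflexivity|]). reflexivity. }
  rewrite E. reflexivity.
Qed.

Definition kept : (nat -> nat) -> Prop := inputs_kept in_np in_trans in_min in_rest R0.

Notation placed := (place_regs in_np in_trans in_min in_rest).

Variables (fuel : nat) (g : nat -> nat).
Hypothesis Hexec : exec D fuel 0 (init [enc_ppn diag_net]) = Some g.

(* Every round, from whatever state the previous cheats left, ends with the verdict of [D]. *)
Lemma machine_round :
  exists e, embedded P e (verdict e) /\ length P = e + 3 /\
    forall v, kept v -> exists n, nsteps P n (0, v) = Some (e, placed g).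
Proof.
  pose (c1 := seqc (clear (seq 10 (R0 - 10))) restore).
  pose (b1 := length (c1 0)). pose (b2 := b1 + length (quine b1)).
  pose (b3 := b2 + length (sim D b2)).
  assert (EP : P = c1 0 ++ quine b1 ++ sim D b2 ++ verdict b3) by reflexivity.
  assert (Hemb : embedded P 0 P) by (intros i ins; auto).
  rewrite EP in Hemb at 2.
  apply embedded_app in Hemb as [He1 Hemb]. apply embedded_app in Hemb as [He2 Hemb].
  apply embedded_app in Hemb as [He3 He4]. rewrite Nat.add_0_l in *. fold b1 in He2, He3, He4.
  fold b2 in He3, He4. fold b3 in He4.
  exists b3. split; [exact He4|]. split.
  { rewrite EP, !length_app. unfold b3, b2, b1. simpl (length (verdict _)). lia. }
  intros v Hv.
  destruct (runs_reset _ _ _ _ R0 v (num_regs_gt D) Hv P 0 He1) as [n1 Hn1].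
  destruct (runs_quine in_np in_trans in_min in_rest P b1 He2) as [n2 Hn2].
  rewrite <- enc_diag_net in Hn2.
  destruct (sim_steps in_np in_trans in_min in_rest D P b2 fuel 0 _ g He3 Hexec) as [n3 Hn3].
  exists (n1 + (n2 + n3)). rewrite (nsteps_add _ _ _ _ _ Hn1). rewrite Nat.add_0_l.
  fold c1 b1. rewrite (nsteps_add _ _ _ _ _ Hn2). fold b2.
  replace (clean in_np in_trans in_min in_rest (enc_ppn diag_net))
    with (placed (init [enc_ppn diag_net])).
  - rewrite Nat.min_0_l, Nat.add_0_r in Hn3. rewrite Hn3. unfold b3. now rewrite length_sim.
  - apply functional_extensionality; intros p. unfold place_regs, init.
    do 14 (destruct p as [|p]; [reflexivity|]). simpl. now destruct p.
Qed.

Lemma kept_clean : kept clean_regs.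
Proof. apply clean_inputs_kept, num_regs_gt. Qed.

Lemma placed_acc : placed g 13 = g 0.
Proof. reflexivity. Qed.

Lemma diag_net_divergent : g 0 <> 1 -> divergent diag_net.
Proof.
  intros Hg. destruct machine_round as (e & He & Hlen & Hround).
  pose proof (num_regs_gt D).
  apply (halting_net_divergent P R0 clean_regs ltac:(lia) (machine_wf D) kept);
    auto using kept_clean, marking_val_computable.
  - intros v Hv; apply Hv.
  - intros v i i' v'. apply inputs_kept_step.
  - intros v Hv. destruct (Hround v Hv) as [n Hn].
    assert (H0 := He 0 _ eq_refl). assert (H1 := He 1 _ eq_refl).
    rewrite Nat.add_0_r in H0. pose proof placed_acc as Ha.
    assert (Hend : nth_error P (e + 3) = None) by (apply nth_error_None; lia).
    destruct (g 0) as [|[|k]] eqn:E; [| easy |].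
    + exists (n + 1). eexists. rewrite (nsteps_add _ _ _ _ _ Hn).
      cbn [nsteps gstep]. rewrite H0, Ha. split; [reflexivity|exact Hend].
    + exists (n + 2). eexists. rewrite (nsteps_add _ _ _ _ _ Hn).
      cbn [nsteps gstep]. rewrite H0, Ha, addl_nil. cbn [nsteps gstep]. rewrite H1.
      change (upd (placed g) 13 (S k) 13) with (S k). split; [reflexivity|exact Hend].
Qed.

(** The reset erases all traces of the previous round, so every faithful round reaches the flag with
    the same registers [v1], and all rounds after the first have the same length [len]. *)
Lemma diag_net_not_divergent : g 0 = 1 -> ~ divergent diag_net.
Proof.
  intros Hg. destruct machine_round as (e & He & Hlen & Hround).
  pose proof (num_regs_gt D).
  set (v1 := upd (placed g) 13 0).
  assert (Hflag : forall v, kept v -> exists n, nsteps P n (0, v) = Some (e + 2, v1)).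
  { intros v Hv. destruct (Hround v Hv) as [n Hn].
    assert (H0 := He 0 _ eq_refl). assert (H1 := He 1 _ eq_refl).
    rewrite Nat.add_0_r in H0. pose proof placed_acc as Ha. rewrite Hg in Ha.
    exists (n + 2). rewrite (nsteps_add _ _ _ _ _ Hn).
    cbn [nsteps gstep]. rewrite H0, Ha, addl_nil. cbn [nsteps gstep]. rewrite H1. reflexivity. }
  assert (Hstep : forall v i i' v', kept v -> gstep P (i, v) = Some (i', v') -> kept v').
  { intros v i i' v'. apply inputs_kept_step. }
  destruct (Hflag clean_regs kept_clean) as [n0 Hn0].
  assert (Hv1 : kept v1) by (eapply I_nsteps; eauto using kept_clean).
  destruct (Hflag v1 Hv1) as [len Hlen1].
  apply (restarting_net_not_divergent P R0 clean_regs ltac:(lia) (machine_wf D) kept)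
    with (fl := e + 2) (n0 := n0) (len := len) (v1 := v1); auto using kept_clean.
  intros v Hv; apply Hv.
Qed.

End Diagonal.

Theorem theorem3 : ~ exists prog : list instr, decides prog divergent.
Proof.
  intros [D HD].
  assert (HV : valid (diag_net D)) by (apply net_valid; pose proof (num_regs_gt D); lia).
  destruct (HD (diag_net D) HV) as (fuel & g & Hexec & Hiff).
  destruct (Nat.eq_dec (g 0) 1) as [E|E].
  - apply (diag_net_not_divergent D fuel g Hexec E). now apply Hiff.
  - apply E, Hiff. now apply (diag_net_divergent D fuel g Hexec).
Qed.
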